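(* Let $V$ be the vertex set of the Kagome lattice and $\Delta_{\mathrm{comb}}$ its combinatorial Laplacian. (a) Let $F:V\to\mathbb{R}$ be a (non-zero) eigenfunction of $\Delta_{\mathrm{comb}}$ with finite support. Then $\Delta_{\mathrm{comb}}F=\frac32F$, and $F$ is a linear combination of finitely many of the hexagon eigenfunctions $F_H$. (b) Let $H_i$ $(i=1,\dots,k)$ be a collection of distinct, albeit not necessarily disjoint, hexagons, and let $F_i:=F_{H_i}$. Then the set $F_1,\dots,F_k$ is linearly independent. (c) If $0\ne g\in\ell^2(V)$ satisfies $\Delta_{\mathrm{comb}}g=\mu g$, then $\mu=3/2$. (d) The space of $\ell^2(V)$-eigenfunctions of $\Delta_{\mathrm{comb}}$ to the eigenvalue $3/2$ is spanned by compactly supported eigenfunctions, i.e. it is the closed linear span in $\ell^2(V)$ of its finitely supported elements.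
   Context: Let $w_1=1$, $w_2=e^{\pi i/3}\in\mathbb{C}$. The Kagome lattice has vertex set $$V=(2\mathbb{Z}w_1+2\mathbb{Z}w_2)\ \sqcup\ (w_1+2\mathbb{Z}w_1+2\mathbb{Z}w_2)\ \sqcup\ (w_2+2\mathbb{Z}w_1+2\mathbb{Z}w_2)\subset\mathbb{C},$$ and $v_1,v_2\in V$ are adjacent, $v_1\sim v_2$, iff $|v_1-v_2|=1$; every vertex has degree $4$. The combinatorial Laplacian is $(\Delta_{\mathrm{comb}}F)(v)=\frac{1}{\deg v}\sum_{w\sim v}(F(v)-F(w))$. A hexagon $H$ is a hexagonal face of this planar graph; its vertices are $\{w_0+e^{k\pi i/3}:k=0,\dots,5\}\subset V$ for a centre $w_0\in\mathbb{C}$ (the centres are the points of $w_1+w_2+2\mathbb{Z}w_1+2\mathbb{Z}w_2$). The function $F_H:V\to\{0,\pm1\}$ is $F_H(w_0+e^{k\pi i/3})=(-1)^k$ for $k=0,\dots,5$ and $F_H(v)=0$ for all other $v\in V$. *)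

(* Defs.v *)
From HB Require Import structures.
From mathcomp Require Import all_boot all_order all_algebra.
From mathcomp Require Import finmap complex.
From mathcomp Require Import all_classical all_reals all_analysis.

Set Implicit Arguments.
Unset Strict Implicit.
Unset Printing Implicit Defensive.

Import Order.TTheory GRing.Theory Num.Theory.
Import numFieldNormedType.Exports.

Local Open Scope classical_set_scope.
Local Open Scope complex_scope.
Local Open Scope ring_scope.

Section linear_algebra_of_functions.
Context {T : Type} {K : fieldType}.

Definition finitely_supported (f : T -> K) : Prop :=
  finite_set [set v | f v != 0].

Definition lin_comb (n : nat) (c : 'I_n -> K) (f : 'I_n -> T -> K) : T -> K :=
  fun v => \sum_(i < n) c i * f i v.

Definition lin_span (S : set (T -> K)) : set (T -> K) :=
  [set g | exists (n : nat) (c : 'I_n -> K) (f : 'I_n -> T -> K),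
    (forall i, S (f i)) /\ g = lin_comb c f].

Definition lin_indep (n : nat) (f : 'I_n -> T -> K) : Prop :=
  forall c : 'I_n -> K, lin_comb c f = cst 0 -> forall i, c i = 0.

End linear_algebra_of_functions.

Section ell2.
Context {R : realType} {T : choiceType}.

(* [complex.Re `|z|] is the real number |z|: the norm on [R[i]] is itself
   [R[i]]-valued. *)
Definition l2normsq (g : T -> R[i]) : \bar R :=
  \esum_(v in [set: T]) (complex.Re `|g v| ^+ 2)%:E.

Definition l2 : set (T -> R[i]) := [set g | (l2normsq g < +oo)%E].

Definition l2_closure (A : set (T -> R[i])) : set (T -> R[i]) :=
  [set g | l2 g /\ forall e : R, 0 < e ->
    exists2 h, A h & (l2normsq (g \- h)%R < (e ^+ 2)%:E)%E].

End ell2.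

Definition expi {R : realType} (t : R) : R[i] := (cos t) +i* (sin t).

Section kagome_lattice.
Variable R : realType.

Definition kagome_w1 : R[i] := 1.
Definition kagome_w2 : R[i] := expi (pi / 3).

Definition even_lattice : set R[i] :=
  [set z | exists m n : int,
    z = (2 * m)%:~R * kagome_w1 + (2 * n)%:~R * kagome_w2].

Definition kagome : set R[i] :=
  even_lattice
  `|` [set kagome_w1 + z | z in even_lattice]
  `|` [set kagome_w2 + z | z in even_lattice].

Definition hexagon_centers : set R[i] :=
  [set kagome_w1 + kagome_w2 + z | z in even_lattice].

Definition kagome_adj (v w : kagome) : Prop := `|val v - val w| = 1.

Definition kagome_nbrs (v : kagome) : set kagome := [set w | kagome_adj v w].

Definition kagome_deg (v : kagome) : nat := #|` fset_set (kagome_nbrs v)|.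

(* A finitary sum over a set is 0 when infinitely many terms are nonzero, and
   [fset_set] of an infinite set is empty; neither happens here, since every
   vertex has exactly four neighbours. *)
Definition laplacian {K : fieldType} (F : kagome -> K) (v : kagome) : K :=
  (kagome_deg v)%:R^-1 * \sum_(w \in kagome_nbrs v) (F v - F w).

Definition lap_eigenspace {K : fieldType} (mu : K) : set (kagome -> K) :=
  [set F | forall v, laplacian F v = mu * F v].

Definition l2_eigenspace (mu : R[i]) : set (kagome -> R[i]) :=
  l2 `&` lap_eigenspace mu.

(* A hexagon is represented by its centre. *)
Definition hexagon : Type := hexagon_centers.

Definition hexagon_vertex (H : hexagon) (k : 'I_6) : R[i] :=
  val H + expi (k%:R * pi / 3).

Definition hexagon_fun {K : fieldType} (H : hexagon) (v : kagome) : K :=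
  if [pick k | val v == hexagon_vertex H k] is Some k then (-1) ^+ k else 0.

End kagome_lattice.

Arguments kagome R : clear implicits.
Arguments hexagon R : clear implicits.
Arguments hexagon_fun {R} K H v.
Arguments l2_eigenspace R mu : clear implicits.

(* Main.v *)
(* Write a vertex as A(m,n), B(m,n) or C(m,n) according to its class modulo
   2Z w1 + 2Z w2.  Every vertex lies in one upward and one downward triangle,
   and [Delta F = mu F] says that [kappa F(v) = U + D], where [kappa = 6 - 4 mu]
   and [U], [D] are the sums of [F] over the two triangles at [v].

   If [kappa <> 0], both [U] and [D] satisfy an eigenvalue equation for the
   triangular lattice Z^2, which has no square-summable solution.  Indeed, if a
   convolution operator [Q] on Z^2 is self- or skew-adjoint and [Q u = 0], then
   [[Q, l] u = 0] for every linear function [l] (virial theorem), and iterating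
   this with the two coordinate functions isolates a single difference of
   translates of [u].

   If [kappa = 0], then [U = - D] is constant, hence [0], so [F] is the curl of
   a stream function [psi] on the hexagons, i.e. formally
   [F = sum_H psi(H) F_H].  When [F] has finite support [psi] is constant near
   infinity, which gives (a).  When [F] is square summable, clipping [psi] and
   multiplying it by cutoffs of small Dirichlet energy, which exist because the
   planar lattice is recurrent, gives (d).  For (b), a finitely supported [psi]
   with vanishing curl is constant along lines, hence [0]. *)

From HB Require Import structures.
Require Import Defs.
From mathcomp Require Import all_boot all_order all_algebra.
From mathcomp Require Import finmap complex.
From mathcomp Require Import all_classical all_reals all_analysis.
From mathcomp Require Import zify ring lra.

Set Implicit Arguments.
Unset Strict Implicit.
Unset Printing Implicit Defensive.

Import Order.TTheory GRing.Theory Num.Theory.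
Import numFieldNormedType.Exports.

Local Open Scope classical_set_scope.
Local Open Scope complex_scope.
Local Open Scope ring_scope.

(** * Square-summable functions *)

Section square_summable.
Context {R : realType}.

Definition sqsum (T : eqType) (f : T -> R) : Prop :=
  exists M, forall s : seq T, uniq s -> \sum_(x <- s) f x ^+ 2 <= M.

Lemma sqsum_le (T : eqType) (f g : T -> R) :
  (forall x, `|f x| <= `|g x|) -> sqsum g -> sqsum f.
Proof.
move=> fg [M HM]; exists M => s us; apply: le_trans (HM s us).
apply: ler_sum => x _; rewrite -[f x ^+ 2]real_normK ?num_real//.
by rewrite -[g x ^+ 2]real_normK ?num_real// lerXn2r ?nnegrE.
Qed.

Lemma sqsumD (T : eqType) (f g : T -> R) :
  sqsum f -> sqsum g -> sqsum (fun x => f x + g x).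
Proof.
move=> [M HM] [N HN]; exists (2 * M + 2 * N) => s us.
apply: (@le_trans _ _ (\sum_(x <- s) (2 * f x ^+ 2 + 2 * g x ^+ 2))).
  apply: ler_sum => x _; have := sqr_ge0 (f x - g x); lra.
rewrite big_split /= -!mulr_sumr.
by rewrite lerD// ler_pM2l ?HM ?HN.
Qed.

Lemma sqsumZ (T : eqType) (c : R) (f : T -> R) :
  sqsum f -> sqsum (fun x => c * f x).
Proof.
move=> [M HM]; exists (c ^+ 2 * M) => s us.
under eq_bigr do rewrite exprMn.
by rewrite -mulr_sumr ler_wpM2l ?sqr_ge0// HM.
Qed.

Lemma sqsum_inj (S T : eqType) (i : S -> T) (f : T -> R) :
  injective i -> sqsum f -> sqsum (f \o i).
Proof.
move=> inj_i [M HM]; exists M => s us.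
by have := HM (map i s); rewrite map_inj_uniq// big_map; apply.
Qed.

Lemma sqsum_big (T I : eqType) (r : seq I) (f : I -> T -> R) :
  (forall i, sqsum (f i)) -> sqsum (fun x => \sum_(i <- r) f i x).
Proof.
move=> hf; elim: r => [|i r IH].
  exists 0 => s _; apply: sumr_le0 => x _; by rewrite big_nil expr0n.
have [M HM] := sqsumD (hf i) IH; exists M => s us.
by under eq_bigr do rewrite big_cons; exact: HM.
Qed.

Lemma sqsum_tail (T : eqType) (f : T -> R) (e : R) :
  sqsum f -> 0 < e -> exists s0 : seq T, forall s, uniq s ->
    {in s, forall x, x \notin s0} -> \sum_(x <- s) f x ^+ 2 <= e.
Proof.
move=> [M HM] e0.
pose E := [set r : R | exists2 s, uniq s & r = \sum_(x <- s) f x ^+ 2].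
have supE : has_sup E.
  split; first by exists 0, [::]; rewrite ?big_nil.
  by exists M => _ [s us ->]; exact: HM.
have [_ [s0 us0 ->] hs0] := sup_adherent e0 supE.
exists s0 => s us sd.
have : \sum_(x <- s ++ s0) f x ^+ 2 <= sup E.
  apply: ub_le_sup; first by case: supE.
  exists (s ++ s0) => //; rewrite cat_uniq us us0 andbT.
  by apply/hasPn => x xs0; apply/negP => /sd; rewrite xs0.
rewrite big_cat /=; lra.
Qed.

Lemma sqsum_const_inj (T : eqType) (i : nat -> T) (f : T -> R) (c : R) :
  injective i -> sqsum f -> (forall n, f (i n) = c) -> c = 0.
Proof.
move=> inji /(sqsum_inj inji)[M HM] fc; apply/eqP; rewrite -sqrf_eq0.
apply/eqP/le_anti; rewrite sqr_ge0 andbT leNgt; apply/negP => c0.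
have := HM (iota 0 (Num.truncn (M / c ^+ 2)).+1) (iota_uniq _ _).
under eq_bigr do rewrite /= fc.
rewrite big_const_seq count_predT size_iota iter_addr_0 -mulr_natr.
rewrite leNgt mulrC -ltr_pdivrMr//.
by rewrite truncnS_gt.
Qed.

End square_summable.

Section box.

Definition znorm (x : int * int) : int := Num.max `|x.1| `|x.2|.

Lemma znorm_ge0 x : 0 <= znorm x.
Proof. rewrite /znorm; lia. Qed.

Lemma znormD x y : znorm (x + y) <= znorm x + znorm y.
Proof. by case: x y => [a b] [c d]; rewrite /znorm /=; lia. Qed.

Lemma znormN x : znorm (- x) = znorm x.
Proof. by case: x => [a b]; rewrite /znorm /= !normrN. Qed.

Definition box (N : nat) : seq (int * int) :=
  [seq (i%:Z - N%:Z, j%:Z - N%:Z) | i <- iota 0 N.*2.+1, j <- iota 0 N.*2.+1].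
Lemma box_uniq N : uniq (box N).
Proof.
apply: allpairs_uniq; rewrite ?iota_uniq// => -[i j] [i' j'] _ _ /= [].
by move=> /addIr[->] /addIr[->].
Qed.

Lemma mem_box N x : (x \in box N) = (znorm x <= N%:Z).
Proof.
case: x => a b; apply/idP/idP.
  case/allpairsP => -[i j] []; rewrite !mem_iota => /= hi hj [-> ->].
  rewrite /znorm /=; lia.
rewrite /znorm /= => h; apply/allpairsP.
exists (absz (a + N%:Z), absz (b + N%:Z)); rewrite !mem_iota /=.
by split; [lia | lia | congr pair; lia].
Qed.

Lemma size_box N : size (box N) = (N.*2.+1 ^ 2)%N.
Proof. by rewrite size_allpairs size_iota. Qed.

Lemma seq_sub_box (s : seq (int * int)) : exists N, {subset s <= box N}.
Proof.
elim: s => [|x s [N HN]]; first by exists 0%N.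
exists (N + absz (znorm x))%N => y; rewrite inE mem_box => /orP[/eqP->|/HN].
  have := znorm_ge0 x; lia.
by rewrite mem_box; lia.
Qed.

Lemma big_shift_box (V : nmodType) (N : nat) (e : int * int)
    (f : int * int -> V) : znorm e <= 1 ->
  (forall x, f x != 0 -> znorm x <= N%:Z) ->
  \sum_(x <- box N.+1) f (x + e) = \sum_(x <- box N.+1) f x.
Proof.
move=> he hf; pose h x := x + e.
have hi : injective h by exact: addIr.
move: (box_uniq N.+1) (mem_box N.+1); move: (box N.+1) => B uB mB.
rewrite -(big_map h xpredT f).
rewrite (bigID (fun x => f x != 0)) /= [X in _ + X]big1 ?addr0; last first.
  by move=> x; rewrite negbK => /eqP.
rewrite [RHS](bigID (fun x => f x != 0)) /= [X in _ = _ + X]big1 ?addr0;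
  last by move=> x; rewrite negbK => /eqP.
rewrite -big_filter -[RHS]big_filter; apply: perm_big; apply: uniq_perm.
- by apply: filter_uniq; rewrite map_inj_uniq.
- exact: filter_uniq.
move=> x; rewrite !mem_filter; case: (boolP (f x != 0)) => //= /hf hx.
rewrite mB; apply/mapP/idP => [_|_]; first lia.
exists (x - e); last by rewrite /h subrK.
rewrite mB; have := znormD x (- e); rewrite znormN; lia.
Qed.

End box.

(** * Eigenfunctions on the triangular lattice *)

Section convolution.
Context {R : realType}.
Implicit Types (a b u f g : int * int -> R) (x e : int * int).

(* The origin is included so that [tri_weight c] can carry the diagonal term. *)
Definition tri : seq (int * int) :=
  [:: 0; (1, 0); (-1, 0); (0, 1); (0, -1); (1, -1); (-1, 1)].

Definition conv a u x : R := \sum_(e <- tri) a e * u (x + e).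

Lemma tri_znorm : {in tri, forall e, znorm e <= 1}.
Proof. by apply/allP. Qed.

Lemma big_triN (F : int * int -> R) :
  \sum_(e <- tri) F (- e) = \sum_(e <- tri) F e.
Proof. by rewrite -(big_map -%R xpredT F); apply: perm_big. Qed.

Lemma convC a b u x : conv a (conv b u) x = conv b (conv a u) x.
Proof.
rewrite /conv; under eq_bigr do rewrite mulr_sumr.
rewrite exchange_big /=; apply: eq_bigr => e _; rewrite mulr_sumr.
by apply: eq_bigr => e' _; rewrite mulrCA -!addrA [e + e']addrC.
Qed.

Lemma conv_commutator a (sigma : R) f g (phi : int * int -> R) (N : nat) :
  (forall e, a (- e) = sigma * a e) ->
  (forall x, phi x != 0 -> znorm x <= N%:Z) ->
  \sum_(x <- box N.+1)
    f x * \sum_(e <- tri) a e * (phi (x + e) - phi x) * g (x + e) =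
  sigma * (\sum_(x <- box N.+1) phi x * g x * conv a f x) -
  \sum_(x <- box N.+1) phi x * f x * conv a g x.
Proof.
move=> aN hphi; set B := box N.+1.
transitivity (\sum_(x <- B) \sum_(e <- tri) f x * a e * phi (x + e) * g (x + e)
    - \sum_(x <- B) phi x * f x * conv a g x).
  rewrite -sumrB; apply: eq_bigr => x _; rewrite /conv !mulr_sumr -sumrB.
  by apply: eq_bigr => e _; ring.
congr (_ - _); rewrite exchange_big /=.
transitivity (\sum_(e <- tri) \sum_(x <- B) f (x - e) * a e * phi x * g x).
  apply: eq_big_seq => e /tri_znorm he.
  rewrite -(@big_shift_box _ N e (fun x => f (x - e) * a e * phi x * g x)) //.
    by apply: eq_bigr => x _; rewrite addrK.
  move=> x h; apply: hphi; apply: contraNneq h => ->.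
  by rewrite mulr0 mul0r.
rewrite -big_triN exchange_big mulr_sumr /=; apply: eq_bigr => x _.
rewrite /conv !mulr_sumr; apply: eq_bigr => e _.
by rewrite opprK aN; ring.
Qed.

Definition plateau (N : nat) (x : int * int) : int :=
  Num.max 0 (2 * N%:Z - znorm x).

Definition clip (b t : int) : int := Num.max (- b) (Num.min b t).

Lemma clip_lip (b b' t t' : int) : `|b - b'| <= 1 -> `|t - t'| <= 1 ->
  `|clip b t - clip b' t'| <= 1.
Proof. by rewrite /clip; lia. Qed.

Lemma plateau_lip N x e : znorm e <= 1 ->
  `|plateau N (x + e) - plateau N x| <= 1.
Proof.
move=> he; have h1 := znormD x e; have := znormD (x + e) (- e).
by rewrite addrK znormN /plateau; lia.
Qed.

Lemma clip_plateau_supp N t x :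
  clip (plateau N x) t != 0 -> znorm x <= (2 * N)%N%:Z.
Proof. by rewrite /clip /plateau; lia. Qed.

Lemma clip_plateau_id N t x : znorm x <= N%:Z -> `|t| <= N%:Z ->
  clip (plateau N x) t = t.
Proof. by rewrite /clip /plateau; lia. Qed.

Lemma sqsum_shift e u : sqsum u -> sqsum (fun x => u (x + e)).
Proof. by move=> hu; apply: (sqsum_inj (addIr e) hu). Qed.

Lemma sqsum_norm (T : eqType) (f : T -> R) :
  sqsum f -> sqsum (fun y => `|f y|).
Proof. by apply: sqsum_le => y; rewrite normr_id. Qed.

Definition absconv a u x : R := \sum_(e <- tri) `|a e| * `|u (x + e)|.

Lemma sqsum_absconv a u : sqsum u -> sqsum (absconv a u).
Proof.
move=> hu; apply: sqsum_big => e; apply: sqsumZ.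
exact: sqsum_norm (sqsum_shift e hu).
Qed.

Lemma absconv_bound a u x (c : int * int -> R) :
  {in tri, forall e, `|c e| <= 1} ->
  `|\sum_(e <- tri) a e * c e * u (x + e)| <= absconv a u x.
Proof.
move=> hc; apply: le_trans (ler_norm_sum _ _ _) _; rewrite /absconv.
rewrite big_seq [leRHS]big_seq; apply: ler_sum => e /hc he.
by rewrite !normrM ler_wpM2r// ler_piMr.
Qed.

(* Pair [conv a (l u)], which is annihilated by [conv a] like [u], with the
   commutator of [conv a] and a compactly supported truncation of [l], applied
   to [u]: this is [0], and up to a tail it is the squared norm of
   [conv (a l) u]. *)
Lemma virial a (sigma : R) (l : int * int -> int) u :
  (forall e, a (- e) = sigma * a e) -> sqsum u ->
  (forall x y, l (x + y) = l x + l y) -> (forall x, `|l x| <= znorm x) ->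
  (forall x, conv a u x = 0) ->
  forall x, conv (fun e => a e * (l e)%:~R) u x = 0.
Proof.
move=> aN hu lD l_le au0 x0.
set w := conv _ u; pose v := absconv a u.
have wv x : `|w x| <= v x.
  apply: absconv_bound => e /tri_znorm he.
  by rewrite -intr_norm (_ : 1 = 1%:~R) // ler_int (le_trans (l_le e)).
have aw0 x : conv a w x = 0.
  rewrite /w convC /conv; under eq_bigr do rewrite -/(conv a u _) au0 mulr0.
  by rewrite big1.
apply: contrapT => /eqP wx0.
have e0 : 0 < w x0 ^+ 2 / 2.
  by rewrite divr_gt0// lt_neqAle sqr_ge0 eq_sym sqrf_eq0 wx0.
have [s0 hs0] := sqsum_tail (sqsum_absconv a hu) e0.
have [N hN] := seq_sub_box (x0 :: s0).
pose phi x : R := (clip (plateau N.+1 x) (l x))%:~R.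
have phi_supp x : phi x != 0 -> znorm x <= (2 * N.+1)%N%:Z.
  by rewrite intr_eq0; exact: clip_plateau_supp.
have phi_id x : znorm x <= N.+1%:Z -> phi x = (l x)%:~R.
  by move=> hx; rewrite /phi clip_plateau_id// (le_trans (l_le x)).
set B := box (2 * N.+1).+1.
pose t x := w x * \sum_(e <- tri) a e * (phi (x + e) - phi x) * u (x + e).
have : \sum_(x <- B) t x = 0.
  rewrite (conv_commutator w u aN phi_supp).
  rewrite [X in _ * X - _]big1 => [|x _]; last by rewrite aw0 mulr0.
  rewrite [X in _ - X]big1 => [|x _]; last by rewrite au0 mulr0.
  by rewrite mulr0 subr0.
rewrite (bigID (fun x => znorm x <= N%:Z)) /=.
have -> : \sum_(x <- B | znorm x <= N%:Z) t x =
          \sum_(x <- B | znorm x <= N%:Z) w x ^+ 2.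
  apply: eq_bigr => x hx; rewrite /t expr2; congr (_ * _).
  apply: eq_big_seq => e /tri_znorm he.
  rewrite !phi_id; [|lia|by have := znormD x e; lia].
  by rewrite lD rmorphD addrAC subrr add0r.
have h1 : w x0 ^+ 2 <= \sum_(x <- B | znorm x <= N%:Z) w x ^+ 2.
  have x0N : znorm x0 <= N%:Z by rewrite -mem_box hN// mem_head.
  rewrite (big_rem x0) ?mem_box; last by lia.
  by rewrite x0N lerDl sumr_ge0// => x _; exact: sqr_ge0.
have h2 : `|\sum_(x <- B | ~~ (znorm x <= N%:Z)) t x| <= w x0 ^+ 2 / 2.
  apply: le_trans (ler_norm_sum _ _ _) _.
  apply: (@le_trans _ _ (\sum_(x <- B | ~~ (znorm x <= N%:Z)) v x ^+ 2)).
    apply: ler_sum => x _; rewrite normrM expr2 ler_pM//.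
    apply: absconv_bound => e /tri_znorm he.
    rewrite -rmorphB /= -intr_norm (_ : 1 = 1%:~R) // ler_int clip_lip//.
      exact: plateau_lip.
    by rewrite lD addrAC subrr add0r (le_trans (l_le e)).
  rewrite -big_filter; apply: hs0; first by rewrite filter_uniq ?box_uniq.
  move=> x; rewrite mem_filter => /andP[hx _]; apply: contra hx => hx.
  by rewrite -mem_box hN// in_cons hx orbT.
move=> h3; have := ler_norm (- \sum_(x <- B | ~~ (znorm x <= N%:Z)) t x).
rewrite normrN; lra.
Qed.

Definition tri_weight (c : R) e : R := if e == 0 then c else 1.

Lemma tri_weightN c e : tri_weight c (- e) = tri_weight c e.
Proof. by rewrite /tri_weight oppr_eq0. Qed.

Lemma tri_eigen0_real (c : R) u : sqsum u ->
  (forall x, conv (tri_weight c) u x = 0) -> forall x, u x = 0.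
Proof.
move=> hu h0.
have [fstD sndD] : (forall x y : int * int, (x + y).1 = x.1 + y.1) /\
  (forall x y : int * int, (x + y).2 = x.2 + y.2) by [].
have [fst_le snd_le] : (forall x : int * int, `|x.1| <= znorm x) /\
  (forall x : int * int, `|x.2| <= znorm x).
  by rewrite /znorm; split=> x; lia.
have aN1 e : tri_weight c (- e) = 1 * tri_weight c e.
  by rewrite mul1r tri_weightN.
have h1 := virial aN1 hu fstD fst_le h0.
have aN2 e : tri_weight c (- e) * (- e).1%:~R =
    -1 * (tri_weight c e * e.1%:~R) by rewrite tri_weightN rmorphN /=; ring.
have h2 := virial (a := fun e => tri_weight c e * e.1%:~R)
  aN2 hu sndD snd_le h1.
have aN3 e : tri_weight c (- e) * (- e).1%:~R * (- e).2%:~R =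
    1 * (tri_weight c e * e.1%:~R * e.2%:~R).
  by rewrite tri_weightN !rmorphN /=; ring.
have h3 := virial (a := fun e => tri_weight c e * e.1%:~R * e.2%:~R)
  aN3 hu fstD fst_le h2.
move=> x; move: (h2 (x - (1, -1))) (h3 (x - (1, -1))).
rewrite /conv /tri !big_cons !big_nil /tri_weight /= subrK.
by lra.
Qed.

(* [p + i q] is an eigenfunction for [alpha + i beta]; testing against a plateau
   of height [N] bounds [N |beta|] times its norm, so [beta = 0]. *)
Lemma tri_eigen0 (alpha beta : R) p q : sqsum p -> sqsum q ->
  (forall x, conv (tri_weight 0) p x = alpha * p x - beta * q x) ->
  (forall x, conv (tri_weight 0) q x = beta * p x + alpha * q x) ->
  forall x, p x = 0 /\ q x = 0.
Proof.
move=> hp hq eqp eqq.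
have weight_split c u x :
    conv (tri_weight c) u x = c * u x + conv (tri_weight 0) u x.
  by rewrite /conv /tri !big_cons !big_nil /tri_weight /= addr0; ring.
have [beta0|beta0] := eqVneq beta 0.
  move=> x; split.
    apply: (tri_eigen0_real (c := - alpha) hp) => y.
    by rewrite weight_split eqp beta0; ring.
  apply: (tri_eigen0_real (c := - alpha) hq) => y.
  by rewrite weight_split eqq beta0; ring.
have [M1 HM1] := hp.
have [M2 HM2] := sqsum_absconv (tri_weight 0) hq.
suff main x0 : p x0 ^+ 2 + q x0 ^+ 2 = 0.
  move=> x; have /eqP := main x; rewrite paddr_eq0 ?sqr_ge0// !sqrf_eq0.
  by move=> /andP[/eqP -> /eqP ->].
apply/eqP; rewrite eq_le addr_ge0 ?sqr_ge0// andbT leNgt; apply/negP => t0.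
set t := _ + _ in t0.
pose N := (absz (znorm x0) + (Num.truncn ((M1 + M2) / (`|beta| * t))).+1)%N.
have x0N : znorm x0 <= N%:Z by rewrite /N; lia.
pose phi x : R := (clip (plateau N x) N%:Z)%:~R.
have phi_supp x : phi x != 0 -> znorm x <= (2 * N)%N%:Z.
  by rewrite intr_eq0; exact: clip_plateau_supp.
have phi_ge0 x : 0 <= phi x by rewrite ler0z /clip /plateau; lia.
have aN e : tri_weight 0 (- e) = 1 * tri_weight 0 e.
  by rewrite mul1r tri_weightN.
have := conv_commutator p q aN phi_supp; set B := box _.
rewrite mul1r -sumrB.
under [X in _ = X -> _]eq_bigr => x _.
  rewrite eqp eqq (_ : _ - _ = - beta * (phi x * (p x ^+ 2 + q x ^+ 2)));
    last by ring.
  over.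
rewrite -mulr_sumr => /(congr1 (@Num.norm _ _)).
rewrite normrM normrN [in X in _ = X]ger0_norm; last first.
  by apply: sumr_ge0 => x _; rewrite mulr_ge0// addr_ge0// sqr_ge0.
move=> h.
have : `|beta| * (N%:R * t) <= M1 + M2.
  apply: (@le_trans _ _
    (`|beta| * \sum_(x <- B) phi x * (p x ^+ 2 + q x ^+ 2))).
    rewrite ler_wpM2l// (big_rem x0) ?mem_box; last by lia.
    rewrite {1}/phi clip_plateau_id//= lerDl sumr_ge0// => x _.
    by rewrite mulr_ge0// addr_ge0// sqr_ge0.
  rewrite -h; apply: le_trans (ler_norm_sum _ _ _) _.
  apply: (@le_trans _ _ (\sum_(x <- B) p x ^+ 2 +
    \sum_(x <- B) absconv (tri_weight 0) q x ^+ 2)); last first.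
    by rewrite lerD ?HM1 ?HM2 ?box_uniq.
  rewrite -big_split /=; apply: ler_sum => x _; rewrite normrM.
  apply: (@le_trans _ _ (`|p x| * absconv (tri_weight 0) q x)).
    rewrite ler_wpM2l//; apply: absconv_bound => e /tri_znorm he.
    rewrite -rmorphB /= -intr_norm (_ : 1 = 1%:~R) // ler_int clip_lip//.
      exact: plateau_lip.
    by rewrite subrr.
  rewrite -[p x ^+ 2]real_normK ?num_real//.
  have := sqr_ge0 (`|p x| - absconv (tri_weight 0) q x).
  have := sqr_ge0 (`|p x| + absconv (tri_weight 0) q x); lra.
apply/negP; rewrite -ltNge mulrCA -ltr_pdivrMr ?mulr_gt0 ?normr_gt0//.
apply: lt_le_trans (truncnS_gt _) _; rewrite ler_nat; exact: leq_addl.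
Qed.

End convolution.

(** * Kagome geometry *)

Section kagome_geometry.
Context {R : realType}.

Lemma cos_pi3 : cos (pi / 3 : R) = 2^-1.
Proof.
have c0 : 0 < cos (pi / 3 : R).
  apply: cos_gt0_pihalf; have := pi_gt0 R; lra.
have h2 : cos (pi / 3 *+ 3 : R) = - 1 by rewrite -mulr_natr divfK// cospi.
rewrite mulrS mulr2n cosD sinD cosD in h2.
have h1 := cos2Dsin2 (pi / 3 : R).
move: c0 h1 h2; set c := cos _; set s := sin _ => c0 h1 h2.
suff : (c + 1) * (2 * c - 1) ^+ 2 = 0.
  by move/eqP; rewrite mulf_eq0 sqrf_eq0 => /orP[] /eqP; lra.
have -> : (c + 1) * (2 * c - 1) ^+ 2 = 4 * c ^+ 3 - 3 * c + 1 by ring.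
have s2 : s * s = 1 - c * c by nra.
have -> : 4 * c ^+ 3 - 3 * c + 1 = c * (c * c - s * s) - s * s * (2 * c) + 1.
  by rewrite s2; ring.
by nra.
Qed.

Lemma sin_pi3_sqr : sin (pi / 3 : R) ^+ 2 = 3 / 4.
Proof. have := cos2Dsin2 (pi / 3 : R); rewrite cos_pi3; lra. Qed.

Lemma sin_pi3_gt0 : 0 < sin (pi / 3 : R).
Proof. by apply: sin_gt0_pi; have := pi_gt0 R; lra. Qed.

Definition emb (p q : int) : R[i] :=
  (p%:~R + q%:~R / 2) +i* (q%:~R * sin (pi / 3)).

Lemma embE p q : emb p q = p%:~R * kagome_w1 R + q%:~R * kagome_w2 R.
Proof.
rewrite /kagome_w1 /kagome_w2 /expi cos_pi3 mulr1 /emb.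
have intE (m : int) : m%:~R = (m%:~R)%:C :> R[i] by rewrite rmorph_int.
by rewrite !intE; apply/eqP; rewrite eq_complex /=; apply/andP; split;
  apply/eqP; ring.
Qed.

Lemma embD p q p' q' : emb p q + emb p' q' = emb (p + p') (q + q').
Proof. by rewrite !embE !rmorphD /=; ring. Qed.

Lemma embB p q p' q' : emb p q - emb p' q' = emb (p - p') (q - q').
Proof. by rewrite !embE !rmorphB /=; ring. Qed.

Lemma emb_inj p q p' q' : emb p q = emb p' q' -> p = p' /\ q = q'.
Proof.
case=> h1 /mulIf h2; have {h2} qq : q = q'.
  by apply: (@intr_inj R); apply: h2; rewrite gt_eqF// sin_pi3_gt0.
by split=> //; apply: (@intr_inj R); move: h1; rewrite qq; lra.
Qed.

Definition unit_vectors : seq (int * int) :=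
  [:: (1, 0); (-1, 0); (0, 1); (0, -1); (1, -1); (-1, 1)].

Lemma unit_normsq (p q : int) :
  p ^+ 2 + p * q + q ^+ 2 = 1 <-> (p, q) \in unit_vectors.
Proof.
split=> [h|]; last by rewrite !inE => /or4P[|||/or3P[]] => /eqP[-> ->].
have hq : `|q| <= 1 by have := sqr_ge0 (2 * p + q); nia.
have hp : `|p| <= 1 by have := sqr_ge0 (2 * q + p); nia.
have {hp} : p = 0 \/ p = 1 \/ p = -1 by lia.
have {hq} : q = 0 \/ q = 1 \/ q = -1 by lia.
by move=> [|[]] ? [|[]] ?; subst.
Qed.

Lemma norm_emb1 p q : `|emb p q| = 1 <-> (p, q) \in unit_vectors.
Proof.
rewrite -unit_normsq.
have -> : (`|emb p q| = 1) <->
    (p%:~R + q%:~R / 2) ^+ 2 + (q%:~R * sin (pi / 3)) ^+ 2 = 1 :> R.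
  rewrite normc_def /=; split=> [[h]|->]; last by rewrite sqrtr1.
  rewrite -[LHS]sqr_sqrtr ?h ?expr1n// addr_ge0 ?sqr_ge0//.
have -> : (p%:~R + q%:~R / 2) ^+ 2 + (q%:~R * sin (pi / 3)) ^+ 2 =
    (p ^+ 2 + p * q + q ^+ 2)%:~R :> R.
  by rewrite exprMn sin_pi3_sqr !expr2 !rmorphD !rmorphM /=; field.
split=> [h|->//]; exact: (@intr_inj R).
Qed.

Lemma even_latticeE (z : R[i]) :
  even_lattice z <-> exists m n : int, z = emb (2 * m) (2 * n).
Proof.
by split=> -[m [n ->]]; exists m, n; rewrite embE.
Qed.

Lemma kagomeA m n : emb (2 * m) (2 * n) \in kagome R.
Proof. by apply/mem_set; left; left; apply/even_latticeE; exists m, n. Qed.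

Lemma kagomeB m n : emb (2 * m + 1) (2 * n) \in kagome R.
Proof.
apply/mem_set; left; right; exists (emb (2 * m) (2 * n)).
  by apply/even_latticeE; exists m, n.
by rewrite !embE rmorphD /=; ring.
Qed.

Lemma kagomeC m n : emb (2 * m) (2 * n + 1) \in kagome R.
Proof.
apply/mem_set; right; exists (emb (2 * m) (2 * n)).
  by apply/even_latticeE; exists m, n.
by rewrite !embE rmorphD /=; ring.
Qed.

Definition vA (x : int * int) : kagome R :=
  exist (fun z => z \in kagome R) _ (kagomeA x.1 x.2).
Definition vB (x : int * int) : kagome R :=
  exist (fun z => z \in kagome R) _ (kagomeB x.1 x.2).
Definition vC (x : int * int) : kagome R :=
  exist (fun z => z \in kagome R) _ (kagomeC x.1 x.2).

Lemma vA_inj : injective vA.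
Proof.
by move=> [m n] [m' n'] /(congr1 val) /emb_inj[] /= ? ?; congr pair; lia.
Qed.

Lemma vB_inj : injective vB.
Proof.
by move=> [m n] [m' n'] /(congr1 val) /emb_inj[] /= ? ?; congr pair; lia.
Qed.

Lemma vC_inj : injective vC.
Proof.
by move=> [m n] [m' n'] /(congr1 val) /emb_inj[] /= ? ?; congr pair; lia.
Qed.

Lemma kagome_ind (P : kagome R -> Prop) :
  (forall x, P (vA x)) -> (forall x, P (vB x)) -> (forall x, P (vC x)) ->
  forall v, P v.
Proof.
move=> PA PB PC v; have := set_mem (valP v).
case=> [[/even_latticeE[m [n e]]|[z /even_latticeE[m [n ->]] e]]|
    [z /even_latticeE[m [n ->]] e]].
- by rewrite (_ : v = vA (m, n)) //; apply: val_inj.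
- rewrite (_ : v = vB (m, n)) //; apply: val_inj; rewrite -e /=.
  by rewrite !embE rmorphD /=; ring.
- rewrite (_ : v = vC (m, n)) //; apply: val_inj; rewrite -e /=.
  by rewrite !embE rmorphD /=; ring.
Qed.

Lemma kagome_adjE (v w : kagome R) p q p' q' :
  val v = emb p q -> val w = emb p' q' ->
  kagome_adj v w <-> (p - p', q - q') \in unit_vectors.
Proof. by rewrite /kagome_adj => -> ->; rewrite embB norm_emb1. Qed.

End kagome_geometry.

Section kagome_operators.
Context {R : realType}.
Notation vA := (@vA R). Notation vB := (@vB R). Notation vC := (@vC R).

Lemma laplacian_seq (K : fieldType) (F : kagome R -> K) v
    (s : seq (kagome R)) : uniq s -> (forall w, kagome_adj v w <-> w \in s) ->
  laplacian F v = (size s)%:R^-1 * \sum_(w <- s) (F v - F w).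
Proof.
move=> us hs.
have nE : kagome_nbrs v = [set` s] by apply/funext => w; exact/propext.
rewrite /laplacian /kagome_deg nE -fsbig_seq//; congr ((_)%:R^-1 * _).
apply: perm_size; apply: uniq_perm => // w.
by rewrite in_fset_set ?mem_setE ?inE/=.
Qed.

Lemma adjA m n w : kagome_adj (vA (m, n)) w <->
  w \in [:: vB (m, n); vB (m - 1, n); vC (m, n); vC (m, n - 1)].
Proof.
split=> [|]; last first.
  by rewrite !inE => /or4P[] /eqP ->; apply/kagome_adjE => //=;
  rewrite !inE !xpair_eqE; lia.
elim/(@kagome_ind R): w => -[p q] /kagome_adjE-/(_ _ _ _ _ erefl erefl) /=;
rewrite !inE !xpair_eqE => h.
- by exfalso; lia.
- have [[-> ->]|[-> ->]] : p = m /\ q = n \/ p = m - 1 /\ q = n by lia.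
    by rewrite eqxx.
  by rewrite eqxx ?orbT.
- have [[-> ->]|[-> ->]] : p = m /\ q = n \/ p = m /\ q = n - 1 by lia.
    by rewrite eqxx ?orbT.
  by rewrite eqxx ?orbT.
Qed.

Lemma adjB m n w : kagome_adj (vB (m, n)) w <->
  w \in [:: vA (m, n); vA (m + 1, n); vC (m, n); vC (m + 1, n - 1)].
Proof.
split=> [|]; last first.
  by rewrite !inE => /or4P[] /eqP ->; apply/kagome_adjE => //=;
  rewrite !inE !xpair_eqE; lia.
elim/(@kagome_ind R): w => -[p q] /kagome_adjE-/(_ _ _ _ _ erefl erefl) /=;
rewrite !inE !xpair_eqE => h.
- have [[-> ->]|[-> ->]] : p = m /\ q = n \/ p = m + 1 /\ q = n by lia.
    by rewrite eqxx.
  by rewrite eqxx ?orbT.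
- by exfalso; lia.
- have [[-> ->]|[-> ->]] : p = m /\ q = n \/ p = m + 1 /\ q = n - 1 by lia.
    by rewrite eqxx ?orbT.
  by rewrite eqxx ?orbT.
Qed.

Lemma adjC m n w : kagome_adj (vC (m, n)) w <->
  w \in [:: vA (m, n); vA (m, n + 1); vB (m, n); vB (m - 1, n + 1)].
Proof.
split=> [|]; last first.
  by rewrite !inE => /or4P[] /eqP ->; apply/kagome_adjE => //=;
  rewrite !inE !xpair_eqE; lia.
elim/(@kagome_ind R): w => -[p q] /kagome_adjE-/(_ _ _ _ _ erefl erefl) /=;
rewrite !inE !xpair_eqE => h.
- have [[-> ->]|[-> ->]] : p = m /\ q = n \/ p = m /\ q = n + 1 by lia.
    by rewrite eqxx.
  by rewrite eqxx ?orbT.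
- have [[-> ->]|[-> ->]] : p = m /\ q = n \/ p = m - 1 /\ q = n + 1 by lia.
    by rewrite eqxx ?orbT.
  by rewrite eqxx ?orbT.
- by exfalso; lia.
Qed.

Lemma vAB x y : vA x != vB y.
Proof. by apply/eqP => /(congr1 val) /emb_inj[]; lia. Qed.

Lemma vAC x y : vA x != vC y.
Proof. by apply/eqP => /(congr1 val) /emb_inj[]; lia. Qed.

Lemma vBC x y : vB x != vC y.
Proof. by apply/eqP => /(congr1 val) /emb_inj[]; lia. Qed.

Section laplacian_values.
Variables (K : numFieldType) (F : kagome R -> K) (m n : int).

Lemma laplacianA : laplacian F (vA (m, n)) = F (vA (m, n)) -
  (F (vB (m, n)) + F (vB (m - 1, n)) + F (vC (m, n)) + F (vC (m, n - 1))) / 4.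
Proof.
rewrite (laplacian_seq _ _ (adjA m n)) ?big_cons ?big_nil /=; first by field.
rewrite !inE !negb_or !vBC /= !(inj_eq vB_inj, inj_eq vC_inj) !xpair_eqE; lia.
Qed.

Lemma laplacianB : laplacian F (vB (m, n)) = F (vB (m, n)) -
  (F (vA (m, n)) + F (vA (m + 1, n)) + F (vC (m, n)) + F (vC (m + 1, n - 1)))
    / 4.
Proof.
rewrite (laplacian_seq _ _ (adjB m n)) ?big_cons ?big_nil /=; first by field.
rewrite !inE !negb_or !vAC /= !(inj_eq vA_inj, inj_eq vC_inj) !xpair_eqE; lia.
Qed.

Lemma laplacianC : laplacian F (vC (m, n)) = F (vC (m, n)) -
  (F (vA (m, n)) + F (vA (m, n + 1)) + F (vB (m, n)) + F (vB (m - 1, n + 1)))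
    / 4.
Proof.
rewrite (laplacian_seq _ _ (adjC m n)) ?big_cons ?big_nil /=; first by field.
rewrite !inE !negb_or !vAB /= !(inj_eq vA_inj, inj_eq vB_inj) !xpair_eqE; lia.
Qed.

End laplacian_values.

Lemma expiD (s t : R) : expi (s + t) = expi s * expi t.
Proof.
rewrite /expi cosD sinD; apply/eqP; rewrite eq_complex /=.
by apply/andP; split; apply/eqP; ring.
Qed.

Definition hex_offset (k : nat) : int * int :=
  nth 0 [:: (1, 0); (0, 1); (-1, 1); (-1, 0); (0, -1); (1, -1)] k.

Lemma expi_hex (k : 'I_6) :
  expi (k%:R * pi / 3) = emb (hex_offset k).1 (hex_offset k).2 :> R[i].
Proof.
have w2E : expi (pi / 3) = emb 0 1 :> R[i].
  by rewrite embE mulr0z mulr1z mul0r add0r mul1r.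
have rot p q : emb p q * expi (pi / 3) = emb (- q) (p + q) :> R[i].
  rewrite w2E /emb; apply/eqP; rewrite eq_complex /= !rmorphD rmorphN /=.
  have := @sin_pi3_sqr R; rewrite expr2 => s2.
  apply/andP; split; apply/eqP; last by field.
  rewrite (_ : _ * _ * _ = q%:~R * (sin (pi / 3) * sin (pi / 3))); last ring.
  by rewrite s2; field.
have step (j : nat) : expi (j.+1%:R * pi / 3) =
    expi (j%:R * pi / 3) * expi (pi / 3) :> R[i].
  by rewrite -expiD -natr1; congr expi; field.
have h0 : expi (0%:R * pi / 3) = emb 1 0 :> R[i].
  by rewrite mul0r mul0r /expi cos0 sin0 embE mulr0z mulr1z mulr1 mul0r addr0.
case: k => [[|[|[|[|[|[|//]]]]]] ?];
  by rewrite /= ?step h0 ?rot; congr emb.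
Qed.

Definition hex_at (x : int * int) : R[i] := emb (2 * x.1 + 1) (2 * x.2 + 1).

Lemma hex_at_center x : hex_at x \in @hexagon_centers R.
Proof.
apply/mem_set; exists (emb (2 * x.1) (2 * x.2)).
  by apply/even_latticeE; exists x.1, x.2.
by rewrite /hex_at !embE !rmorphD /=; ring.
Qed.

Definition hex (x : int * int) : hexagon R :=
  exist (fun z => z \in @hexagon_centers R) _ (hex_at_center x).

Lemma hex_surj H : exists x, H = hex x.
Proof.
have [_ /even_latticeE[m [n ->]] e] := set_mem (valP H).
exists (m, n); apply: val_inj; rewrite -e /= /hex_at.
by rewrite !embE !rmorphD /=; ring.
Qed.

Lemma hexagon_vertexE x (k : 'I_6) : hexagon_vertex (hex x) k =
  emb (2 * x.1 + 1 + (hex_offset k).1) (2 * x.2 + 1 + (hex_offset k).2).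
Proof. by rewrite /hexagon_vertex expi_hex /= /hex_at embD. Qed.

End kagome_operators.

(** * The eigenvalue *)

Section eigenvalue.
Context {R : realType}.
Notation vA := (@vA R). Notation vB := (@vB R). Notation vC := (@vC R).

Lemma tri_eigen0_complex (c : R[i]) (u : int * int -> R[i]) :
  sqsum (fun x => complex.Re (u x)) -> sqsum (fun x => complex.Im (u x)) ->
  (forall m n, u (m + 1, n) + u (m - 1, n) + u (m, n + 1) + u (m, n - 1) +
     u (m + 1, n - 1) + u (m - 1, n + 1) = c * u (m, n)) ->
  forall x, u x = 0.
Proof.
move=> hp hq hu x.
have h y : conv (tri_weight 0) (fun x => complex.Re (u x)) y =
      complex.Re c * complex.Re (u y) - complex.Im c * complex.Im (u y) /\
    conv (tri_weight 0) (fun x => complex.Im (u x)) y =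
      complex.Im c * complex.Re (u y) + complex.Re c * complex.Im (u y).
  case: y => m n; have := hu m n.
  rewrite /conv /tri !big_cons !big_nil /tri_weight /=.
  rewrite mul0r !mul1r !add0r addr0.
  have pairD (i j k l : int) : (i, j) + (k, l) = (i + k, j + l) by [].
  rewrite !pairD !addr0.
  case: c (u (m, n)) (u (m + 1, n)) (u (m - 1, n)) (u (m, n + 1)) (u (m, n - 1))
    (u (m + 1, n - 1)) (u (m - 1, n + 1)) {hu}
    => c1 c2 [? ?] [? ?] [? ?] [? ?] [? ?] [? ?] [? ?] /= [h1 h2].
  by split; lra.
have [h1 h2] := tri_eigen0 hp hq (fun y => (h y).1) (fun y => (h y).2) x.
by apply/eqP; rewrite eq_complex h1 h2 !eqxx.
Qed.

Definition up_sum (K : zmodType) (F : kagome R -> K) (x : int * int) : K :=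
  F (vA x) + F (vB x) + F (vC x).

Definition down_sum (K : zmodType) (F : kagome R -> K) (x : int * int) : K :=
  F (vA x) + F (vB (x.1 - 1, x.2)) + F (vC (x.1, x.2 - 1)).

Section triangle_sums.
Variables (K : numFieldType) (mu : K) (F : kagome R -> K).
Hypothesis Fmu : lap_eigenspace mu F.
Let kappa : K := 6 - 4 * mu.
Notation U := (up_sum F).
Notation D := (down_sum F).

Lemma eigenA m n : kappa * F (vA (m, n)) = U (m, n) + D (m, n).
Proof.
have /esym := Fmu (vA (m, n)); rewrite laplacianA /up_sum /down_sum /=.
by rewrite /kappa mulrBl -mulrA => ->; field.
Qed.

Lemma eigenB m n : kappa * F (vB (m, n)) = U (m, n) + D (m + 1, n).
Proof.
have /esym := Fmu (vB (m, n)); rewrite laplacianB /up_sum /down_sum /= addrK.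
by rewrite /kappa mulrBl -mulrA => ->; field.
Qed.

Lemma eigenC m n : kappa * F (vC (m, n)) = U (m, n) + D (m, n + 1).
Proof.
have /esym := Fmu (vC (m, n)); rewrite laplacianC /up_sum /down_sum /= addrK.
by rewrite /kappa mulrBl -mulrA => ->; field.
Qed.

Lemma eigen_up m n :
  (kappa - 3) * U (m, n) = D (m, n) + D (m + 1, n) + D (m, n + 1).
Proof.
have h : kappa * U (m, n) = kappa * F (vA (m, n)) + kappa * F (vB (m, n)) +
    kappa * F (vC (m, n)) by rewrite -!mulrDr.
by rewrite mulrBl h eigenA eigenB eigenC; ring.
Qed.

Lemma eigen_down m n :
  (kappa - 3) * D (m, n) = U (m, n) + U (m - 1, n) + U (m, n - 1).
Proof.
have h : kappa * D (m, n) = kappa * F (vA (m, n)) + kappa * F (vB (m - 1, n)) +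
    kappa * F (vC (m, n - 1)) by rewrite -!mulrDr.
by rewrite mulrBl h eigenA eigenB eigenC !subrK; ring.
Qed.

Lemma eigen_up_tri m n :
  U (m + 1, n) + U (m - 1, n) + U (m, n + 1) + U (m, n - 1) +
  U (m + 1, n - 1) + U (m - 1, n + 1) = ((kappa - 3) ^+ 2 - 3) * U (m, n).
Proof.
have h := eigen_up m n.
have e1 := eigen_down m n; have e2 := eigen_down (m + 1) n.
have e3 := eigen_down m (n + 1); rewrite !addrK in e2 e3.
transitivity ((kappa - 3) * ((kappa - 3) * U (m, n)) - 3 * U (m, n)); last ring.
by rewrite h 2!mulrDr e1 e2 e3; ring.
Qed.

Lemma eigen_down_tri m n :
  D (m + 1, n) + D (m - 1, n) + D (m, n + 1) + D (m, n - 1) +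
  D (m + 1, n - 1) + D (m - 1, n + 1) = ((kappa - 3) ^+ 2 - 3) * D (m, n).
Proof.
have h := eigen_down m n.
have e1 := eigen_up m n; have e2 := eigen_up (m - 1) n.
have e3 := eigen_up m (n - 1); rewrite !subrK in e2 e3.
transitivity ((kappa - 3) * ((kappa - 3) * D (m, n)) - 3 * D (m, n)); last ring.
by rewrite h 2!mulrDr e1 e2 e3; ring.
Qed.

End triangle_sums.

Lemma sqsum_up_sum (g : kagome R -> R) : sqsum g -> sqsum (up_sum g).
Proof.
move=> hg; rewrite /up_sum.
by apply: sqsumD; [apply: sqsumD|]; apply: sqsum_inj hg;
  [exact: vA_inj|exact: vB_inj|exact: vC_inj].
Qed.

Lemma sqsum_down_sum (g : kagome R -> R) : sqsum g -> sqsum (down_sum g).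
Proof.
move=> hg; rewrite /down_sum.
apply: sqsumD; [apply: sqsumD|].
- by apply: sqsum_inj hg; exact: vA_inj.
- apply: (sqsum_inj (i := fun x : int * int => vB (x.1 - 1, x.2))) hg.
  by move=> [a b] [a' b'] /vB_inj[] /addIr -> ->.
- apply: (sqsum_inj (i := fun x : int * int => vC (x.1, x.2 - 1))) hg.
  by move=> [a b] [a' b'] /vC_inj[] -> /addIr ->.
Qed.

Lemma complex_ReD (z w : R[i]) :
  complex.Re (z + w) = complex.Re z + complex.Re w.
Proof. by case: z w => ? ? []. Qed.

Lemma complex_ImD (z w : R[i]) :
  complex.Im (z + w) = complex.Im z + complex.Im w.
Proof. by case: z w => ? ? []. Qed.

Lemma sqsum_eigenvalue (g : kagome R -> R[i]) mu :
  sqsum (fun v => complex.Re (g v)) -> sqsum (fun v => complex.Im (g v)) ->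
  g <> cst 0 -> lap_eigenspace mu g -> mu = 3 / 2.
Proof.
move=> hp hq g0 gmu.
have U0 : forall x, up_sum g x = 0.
  apply: (tri_eigen0_complex _ _ (eigen_up_tri gmu)).
    by apply: sqsum_le (sqsum_up_sum hp) => x;
      rewrite /up_sum !complex_ReD.
  by apply: sqsum_le (sqsum_up_sum hq) => x;
      rewrite /up_sum !complex_ImD.
have D0 : forall x, down_sum g x = 0.
  apply: (tri_eigen0_complex _ _ (eigen_down_tri gmu)).
    by apply: sqsum_le (sqsum_down_sum hp) => x;
      rewrite /down_sum !complex_ReD.
  by apply: sqsum_le (sqsum_down_sum hq) => x;
      rewrite /down_sum !complex_ImD.
have [k0|k0] := eqVneq (6 - 4 * mu) 0.
  apply: (mulfI (x := 4)) => //.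
  by have /eqP := k0; rewrite subr_eq0 => /eqP <-; field.
exfalso; apply: g0; apply/funext; elim/(@kagome_ind R) => -[m n];
  apply: (mulfI k0); rewrite mulr0.
- by rewrite (eigenA gmu) U0 D0 addr0.
- by rewrite (eigenB gmu) U0 D0 addr0.
- by rewrite (eigenC gmu) U0 D0 addr0.
Qed.

Lemma int_const_ext (T : Type) (f : int -> T) :
  (forall n, f (n + 1) = f n) -> forall n, f n = f 0.
Proof.
move=> h; elim/int_rec => // n IH; first by rewrite -addn1 PoszD h.
by rewrite -IH -(h (- n.+1%:Z)) -addn1 PoszD opprD addrK.
Qed.

Definition balanced (K : zmodType) (F : kagome R -> K) : Prop := forall m n,
  [/\ up_sum F (m, n) + down_sum F (m, n) = 0,
      up_sum F (m, n) + down_sum F (m + 1, n) = 0 &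
      up_sum F (m, n) + down_sum F (m, n + 1) = 0].

Lemma eigen_balanced (K : numFieldType) (F : kagome R -> K) :
  lap_eigenspace (3 / 2) F <-> balanced F.
Proof.
split=> [Fmu m n|hF].
  have k0 : 6 - 4 * (3 / 2) = 0 :> K by field.
  by rewrite -(eigenA Fmu) -(eigenB Fmu) -(eigenC Fmu) k0 !mul0r.
have aux (a s : K) : a + a + s = 0 -> a - s / 4 = 3 / 2 * a.
  by move=> /eqP; rewrite addrC addr_eq0 => /eqP ->; field.
elim/(@kagome_ind R) => -[m n]; have [hA hB hC] := hF m n.
- by rewrite laplacianA; apply: aux; rewrite -hA /up_sum /down_sum /=; ring.
- rewrite laplacianB; apply: aux; rewrite -hB /up_sum /down_sum /= addrK; ring.
- rewrite laplacianC; apply: aux; rewrite -hC /up_sum /down_sum /= addrK; ring.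
Qed.

Lemma triangle_sums0 (F : kagome R -> R) : sqsum F -> balanced F ->
  (forall x, up_sum F x = 0) /\ (forall x, down_sum F x = 0).
Proof.
move=> hF hb.
have eA m n : up_sum F (m, n) + down_sum F (m, n) = 0 by case: (hb m n).
have eB m n : up_sum F (m, n) + down_sum F (m + 1, n) = 0 by case: (hb m n).
have eC m n : up_sum F (m, n) + down_sum F (m, n + 1) = 0 by case: (hb m n).
have D_const x : down_sum F x = down_sum F 0.
  case: x => m n; transitivity (down_sum F (0, n)).
    apply: (int_const_ext (f := fun m => down_sum F (m, n))) => j.
    by have := eA j n; have := eB j n; lra.
  apply: (int_const_ext (f := fun n => down_sum F (0, n))) => j.
  by have := eA 0 j; have := eC 0 j; lra.
have D0 x : down_sum F x = 0.
  rewrite D_const; apply: (sqsum_const_inj (i := fun n => (n%:Z, 0 : int)) _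
    (sqsum_down_sum hF)) => [i j [] //|n]; exact: D_const.
split=> // -[m n]; have := eA m n; rewrite D0; lra.
Qed.

End eigenvalue.

(** * Stream functions *)

Section stream.
Context {R : realType}.
Notation vA := (@vA R). Notation vB := (@vB R). Notation vC := (@vC R).

(* [F] is the sum of the [psi x *: F_H] over the hexagons [H = hex x], written
   out at each vertex as the difference over the two hexagons containing it. *)
Definition is_stream (K : zmodType) (psi : int * int -> K)
    (F : kagome R -> K) : Prop := forall m n,
  [/\ F (vA (m, n)) = psi (m, n - 1) - psi (m - 1, n),
      F (vB (m, n)) = psi (m, n) - psi (m, n - 1) &
      F (vC (m, n)) = psi (m - 1, n) - psi (m, n)].

Lemma hexagon_funE (K : fieldType) m n (v : kagome R) p q :
  val v = emb p q -> hexagon_fun K (hex (m, n)) v =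
    ((p == 2 * m + 2) && (q == 2 * n + 1))%:R -
    ((p == 2 * m + 1) && (q == 2 * n + 2))%:R +
    ((p == 2 * m) && (q == 2 * n + 2))%:R -
    ((p == 2 * m) && (q == 2 * n + 1))%:R +
    ((p == 2 * m + 1) && (q == 2 * n))%:R -
    ((p == 2 * m + 2) && (q == 2 * n))%:R.
Proof.
move=> vE; have atE (k : 'I_6) : (val v == hexagon_vertex (hex (m, n)) k) =
    ((p, q) == (2 * m + 1 + (hex_offset k).1, 2 * n + 1 + (hex_offset k).2)).
  rewrite vE hexagon_vertexE /=; apply/eqP/eqP => [/emb_inj[-> ->] //|].
  by case=> -> ->.
transitivity (\sum_(k < 6) (-1) ^+ k *
    ((p, q) == (2 * m + 1 + (hex_offset k).1,
                2 * n + 1 + (hex_offset k).2))%:R : K).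
  rewrite /hexagon_fun; case: pickP => [k|none]; last first.
    by rewrite big1 // => k _; rewrite -atE none mulr0.
  rewrite atE => /eqP e; rewrite (bigD1 k) //= e eqxx mulr1 big1 ?addr0//.
  move=> j jk; case: eqP => [[]|]; last by rewrite mulr0.
  move/addrI => h1 /addrI h2; case/eqP: jk; apply: val_inj.
  move: j k h1 h2 {e}.
  by case=> [[|[|[|[|[|[|//]]]]]] ?] [[|[|[|[|[|[|//]]]]]] ?].
rewrite !big_ord_recr big_ord0 /= !xpair_eqE.
have h2 j : 2 * j + 1 + 1 = 2 * j + 2 :> int by rewrite -addrA.
by rewrite !h2 !addr0 !addrK; ring.
Qed.

Lemma hexagon_stream (K : fieldType) x :
  is_stream (fun y => (x == y)%:R) (hexagon_fun K (hex x)).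
Proof.
case: x => k l m n; rewrite !xpair_eqE.
have F (b : bool) : b = false -> b%:R = 0 :> K by move=> ->.
have E (b c : bool) : b = c -> b%:R = c%:R :> K by move=> ->.
split.
- rewrite (@hexagon_funE K k l (vA (m, n)) (2 * m) (2 * n) erefl).
  rewrite F; last lia.
  rewrite [X in _ - X + _ - _ + _ - _]F; last lia.
  rewrite [X in _ - X + _ - _]F; last lia.
  rewrite [X in _ + X - _]F; last lia.
  rewrite !(subr0, add0r, addr0); congr (_ - _); apply: E; lia.
- rewrite (@hexagon_funE K k l (vB (m, n)) (2 * m + 1) (2 * n) erefl).
  rewrite F; last lia.
  rewrite [X in _ - _ + X - _ + _ - _]F; last lia.
  rewrite [X in _ - X + _ - _]F; last lia.
  rewrite [X in _ - X]F; last lia.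
  rewrite !(subr0, add0r, addr0) addrC; congr (_ - _); apply: E; lia.
- rewrite (@hexagon_funE K k l (vC (m, n)) (2 * m) (2 * n + 1) erefl).
  rewrite [X in _ - X + _ - _ + _ - _]F; last lia.
  rewrite [X in _ - _ + X - _ + _ - _]F; last lia.
  rewrite [X in _ + X - _]F; last lia.
  rewrite [X in _ - X]F; last lia.
  rewrite !(subr0, add0r, addr0); congr (_ - _); apply: E; lia.
Qed.

Lemma is_stream_sum (K : pzRingType) (I : Type) (r : seq I) (c : I -> K)
    (psi : I -> int * int -> K) (F : I -> kagome R -> K) :
  (forall i, is_stream (psi i) (F i)) ->
  is_stream (fun y => \sum_(i <- r) c i * psi i y)
    (fun v => \sum_(i <- r) c i * F i v).
Proof.
move=> h m n; rewrite -!sumrB; split; apply: eq_bigr => i _;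
  by have [eA eB eC] := h i m n; rewrite -mulrBr ?eA ?eB ?eC.
Qed.

Lemma is_stream_inj (K : zmodType) (psi : int * int -> K) F G :
  is_stream psi F -> is_stream psi G -> F = G.
Proof.
move=> hF hG; apply/funext; elim/(@kagome_ind R) => -[m n];
  by have [? ? ?] := hF m n; have [? ? ?] := hG m n; congruence.
Qed.

Lemma stream_balanced (K : zmodType) (psi : int * int -> K) F :
  is_stream psi F -> balanced F.
Proof.
move=> h; have U0 m n : up_sum F (m, n) = 0.
  rewrite /up_sum; have [-> -> ->] := h m n.
  by rewrite [X in X + _]addrC !addrA !subrK subrr.
have D0 m n : down_sum F (m, n) = 0.
  rewrite /down_sum /=; have [-> _ _] := h m n.
  have [_ -> _] := h (m - 1) n; have [_ _ ->] := h m (n - 1).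
  by rewrite !addrA !subrK subrr.
by move=> m n; rewrite U0 !D0 addr0.
Qed.

Lemma int_antiderivative (V : zmodType) (f : int -> V) :
  exists S : int -> V, S 0 = 0 /\ forall n, S n = S (n - 1) + f n.
Proof.
exists (fun n => match n with
  | Posz k => \sum_(i < k) f i.+1%:Z
  | Negz k => - \sum_(i < k.+1) f (- i%:Z) end).
split=> [|[[|k]|k]]; first by rewrite /= big_ord0.
- rewrite [0 - 1](_ : _ = Negz 0) //=.
  by rewrite big_ord0 big_ord_recr big_ord0 /= add0r addNr.
- by rewrite [_ - 1](_ : _ = k%:Z); [rewrite /= big_ord_recr|lia].
- rewrite [_ - 1](_ : _ = Negz k.+1); last lia.
  by rewrite [in RHS]big_ord_recr /= opprD -NegzE subrK.
Qed.

Lemma stream_exists (F : kagome R -> R) :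
  (forall x, up_sum F x = 0) -> (forall x, down_sum F x = 0) ->
  exists psi, is_stream psi F.
Proof.
move=> hU hD.
have [S [S0 hS]] := int_antiderivative (fun m => - F (vC (m, 0))).
have /choice[T hT] : forall m, exists T : int -> R, T 0 = 0 /\
    forall n, T n = T (n - 1) + F (vB (m, n)).
  by move=> m; exact: int_antiderivative.
exists (fun x => S x.1 + T x.1 x.2).
suff h m n : F (vC (m, n)) = S (m - 1) + T (m - 1) n - (S m + T m n).
  move=> m n /=; have hB := (hT m).2 n; have hC := h m n.
  have hA := hU (m, n); rewrite /up_sum in hA.
  have hC' := h m (n - 1); have := hD (m, n); rewrite /down_sum /= => hA'.
  have hB' := (hT (m - 1)).2 n.
  by split=> //; lra.
pose e n := F (vC (m, n)) - (S (m - 1) + T (m - 1) n - (S m + T m n)).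
suff : e n = 0 by move/eqP; rewrite subr_eq0 => /eqP.
have -> : e n = e 0.
  apply: int_const_ext => j; rewrite /e [T m (j + 1)](hT m).2.
  rewrite [T (m - 1) (j + 1)](hT _).2 addrK.
  have := hU (m, j + 1); have := hD (m, j + 1).
  by rewrite /up_sum /down_sum /= addrK; lra.
by have := hS m; rewrite /e (hT m).1 (hT (m - 1)).1; lra.
Qed.

End stream.

Section finite_support.
Context {R : realType}.
Notation vA := (@vA R). Notation vB := (@vB R). Notation vC := (@vC R).

Definition kbox (N : nat) : seq (kagome R) :=
  map vA (box N) ++ map vB (box N) ++ map vC (box N).

Lemma mem_kboxA N x : (vA x \in kbox N) = (znorm x <= N%:Z).
Proof.
rewrite !mem_cat mem_map ?mem_box; last exact: vA_inj.
rewrite orb_idr// => /orP[] /mapP[y _ /eqP].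
  by rewrite (negPf (vAB _ _)).
by rewrite (negPf (vAC _ _)).
Qed.

Lemma mem_kboxB N x : (vB x \in kbox N) = (znorm x <= N%:Z).
Proof.
rewrite !mem_cat mem_map ?mem_box; last exact: vB_inj.
have -> : (vB x \in map vA (box N)) = false.
  by apply/mapP => -[y _ /eqP]; rewrite eq_sym (negPf (vAB _ _)).
have -> : (vB x \in map vC (box N)) = false.
  by apply/mapP => -[y _ /eqP]; rewrite (negPf (vBC _ _)).
by rewrite orbF.
Qed.

Lemma mem_kboxC N x : (vC x \in kbox N) = (znorm x <= N%:Z).
Proof.
rewrite !mem_cat mem_map ?mem_box; last exact: vC_inj.
have -> : (vC x \in map vA (box N)) = false.
  by apply/mapP => -[y _ /eqP]; rewrite eq_sym (negPf (vAC _ _)).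
have -> //: (vC x \in map vB (box N)) = false.
by apply/mapP => -[y _ /eqP]; rewrite eq_sym (negPf (vBC _ _)).
Qed.

Lemma size_kbox N : size (kbox N) = (3 * N.*2.+1 ^ 2)%N.
Proof. by rewrite !size_cat !size_map !size_box; lia. Qed.

Lemma seq_sub_kbox (s : seq (kagome R)) : exists N, {subset s <= kbox N}.
Proof.
elim: s => [|v s [N HN]]; first by exists 0%N.
have mono M M' : (M <= M')%N -> {subset kbox M <= kbox M'}.
  move=> MM'; elim/(@kagome_ind R) => x;
    rewrite ?mem_kboxA ?mem_kboxB ?mem_kboxC; lia.
have [M HM] : exists M, v \in kbox M.
  by elim/(@kagome_ind R): v => x; exists (absz (znorm x));
    rewrite ?mem_kboxA ?mem_kboxB ?mem_kboxC; lia.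
exists (maxn N M) => w; rewrite inE => /orP[/eqP ->|/HN].
  by apply: mono HM; exact: leq_maxr.
by apply: mono; exact: leq_maxl.
Qed.

Lemma finitely_supported_kbox (K : fieldType) (F : kagome R -> K) :
  finitely_supported F <-> exists N, forall v, v \notin kbox N -> F v = 0.
Proof.
split=> [/finite_seqP[s hs]|[N HN]].
  have [N HN] := seq_sub_kbox s; exists N => v /negP vN; apply: contrapT => Fv.
  apply: vN; apply: HN; have : [set v | F v != 0] v by exact/eqP.
  by rewrite hs.
apply: sub_finite_set (finite_seq (kbox N)) => v /= Fv.
by apply: contraNT Fv => /HN ->.
Qed.

Lemma stream_finite_support (K : zmodType) (psi : int * int -> K) F N :
  is_stream psi F -> (forall v, v \notin kbox N -> F v = 0) ->
  exists psi', is_stream psi' F /\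
    forall x, x \notin box N -> psi' x = 0.
Proof.
move=> hpsi hF; pose M := N.+1%:Z.
have hstep m n : ~~ (znorm (m, n) <= N%:Z) ->
    psi (m, n) = psi (m, n - 1) /\ psi (m, n) = psi (m - 1, n).
  move=> h; have [_ hB hC] := hpsi m n.
  rewrite hF ?mem_kboxB// in hB; rewrite hF ?mem_kboxC// in hC.
  by split; apply/eqP; rewrite -subr_eq0 -?hB//; rewrite -oppr_eq0 opprB -hC.
have hrow m n : ~~ (`|n| <= N%:Z) -> psi (m, n) = psi (M, n).
  move=> hn; rewrite (int_const_ext (f := fun m => psi (m, n))) => [|j].
    rewrite [RHS](int_const_ext (f := fun m => psi (m, n)))// => j.
    by rewrite (hstep _ _ _).2 ?addrK// /znorm /=; lia.
  by rewrite (hstep _ _ _).2 ?addrK// /znorm /=; lia.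
have hcol m n : ~~ (`|m| <= N%:Z) -> psi (m, n) = psi (m, M).
  move=> hm; rewrite (int_const_ext (f := fun n => psi (m, n))) => [|j].
    rewrite [RHS](int_const_ext (f := fun n => psi (m, n)))// => j.
    by rewrite (hstep _ _ _).1 ?addrK// /znorm /=; lia.
  by rewrite (hstep _ _ _).1 ?addrK// /znorm /=; lia.
exists (fun x => psi x - psi (M, M)); split=> [m n|[m n]].
  have [-> -> ->] := hpsi m n.
  have e (u v w : K) : u - w - (v - w) = u - v by rewrite opprB addrA subrK.
  by rewrite !e.
rewrite mem_box => h; apply/eqP; rewrite subr_eq0; apply/eqP.
have [hn|hn] := boolP (`|n| <= N%:Z).
  by rewrite hcol ?hrow //; move: h; rewrite /znorm /M /=; lia.
by rewrite hrow// hcol// /M; lia.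
Qed.

Lemma finite_stream (K : fieldType) (psi : int * int -> K) N :
  (forall x, x \notin box N -> psi x = 0) ->
  is_stream psi (fun v : kagome R =>
    \sum_(x <- box N) psi x * hexagon_fun K (hex x) v).
Proof.
move=> h0; have := is_stream_sum (box N) psi (hexagon_stream (R := R) K).
congr (is_stream _ _); apply/funext => y.
have [yN|yN] := boolP (y \in box N).
  rewrite (bigD1_seq y) ?box_uniq//= eqxx mulr1 big1 ?addr0// => x /negPf ->.
  by rewrite mulr0.
rewrite big1_seq ?h0// => x xN; case: eqP => [e|_]; last by rewrite mulr0.
by rewrite e (negPf yN) in xN.
Qed.

Lemma lin_span_hexagon (K : fieldType) (psi : int * int -> K)
    (F : kagome R -> K) N :
  is_stream psi F -> (forall x, x \notin box N -> psi x = 0) ->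
  lin_span [set hexagon_fun K H | H in [set: hexagon R]] F.
Proof.
move=> hF h0; pose pt (i : 'I_(size (box N))) := nth 0 (box N) i.
exists (size (box N)), (fun i => psi (pt i)),
  (fun i => hexagon_fun K (hex (pt i))).
split=> [i|]; first by exists (hex (pt i)).
rewrite (is_stream_inj hF (finite_stream h0)); apply/funext => v.
by rewrite (big_nth 0) big_mkord.
Qed.

Lemma hexagon_fun_indep (K : fieldType) (k : nat) (H : 'I_k -> hexagon R) :
  injective H -> lin_indep (fun i => hexagon_fun K (H i)).
Proof.
move=> injH c c0.
have /choice[x hx] : forall i, exists x, H i = hex x.
  by move=> i; exact: hex_surj.
pose psi y : K := \sum_(i < k) c i * (x i == y)%:R.
have hpsi : is_stream psi (lin_comb c (fun i => hexagon_fun K (H i))).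
  by apply: is_stream_sum => i; rewrite hx; exact: hexagon_stream.
have psi_col m n : psi (m, n) = psi (m, 0).
  apply: (int_const_ext (f := fun n => psi (m, n))) => j.
  have [_ + _] := hpsi m (j + 1); rewrite c0 addrK => /esym/eqP.
  by rewrite subr_eq0 => /eqP.
have psi0 y : psi y = 0.
  have [N HN] := seq_sub_box (map x (enum 'I_k)).
  case: y => m n; rewrite psi_col -(psi_col _ N.+1%:Z) /psi big1 // => i _.
  case: eqP => [xi|_]; last by rewrite mulr0.
  have : x i \in box N by apply: HN; rewrite map_f// mem_enum.
  by rewrite xi mem_box /znorm /=; lia.
move=> i; rewrite -(psi0 (x i)) /psi (bigD1 i)//= eqxx mulr1 big1 ?addr0// => j.
move=> ji; case: eqP => [xji|_]; last by rewrite mulr0.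
by case/eqP: ji; apply: injH; rewrite !hx xji.
Qed.

End finite_support.

(** * Cutoffs of small energy *)

Section approximation.
Context {R : realType}.
Notation vA := (@vA R). Notation vB := (@vB R). Notation vC := (@vC R).

Lemma stream_ends : exists a b : kagome R -> int * int,
  [/\ forall v, znorm (a v - b v) <= 1,
      forall v (N : nat), znorm (a v) <= N%:Z -> v \in kbox N.+1 &
      forall (psi : int * int -> R) F, is_stream psi F ->
        forall v, F v = psi (a v) - psi (b v)].
Proof.
have : forall v : kagome R, exists ab : (int * int) * (int * int),
  [/\ znorm (ab.1 - ab.2) <= 1,
      forall N : nat, znorm ab.1 <= N%:Z -> v \in kbox N.+1 &
      forall (psi : int * int -> R) F, is_stream psi F ->
        F v = psi ab.1 - psi ab.2].
  apply: kagome_ind => -[m n].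
  - exists ((m, n - 1), (m - 1, n)); split=> [|N|psi F /(_ m n)[]//].
      by rewrite /znorm /=; lia.
    by rewrite mem_kboxA /znorm /=; lia.
  - exists ((m, n), (m, n - 1)); split=> [|N|psi F /(_ m n)[]//].
      by rewrite /znorm /=; lia.
    by rewrite mem_kboxB /znorm /=; lia.
  - exists ((m - 1, n), (m, n)); split=> [|N|psi F /(_ m n)[]//].
      by rewrite /znorm /=; lia.
    by rewrite mem_kboxC /znorm /=; lia.
move=> /choice[c hc]; exists (fun v => (c v).1), (fun v => (c v).2).
by split=> [v|v N|psi F h v]; have [h1 h2 h3] := hc v; [|exact: h2|exact: h3].
Qed.

Section cutoff.
Variables a b : kagome R -> int * int.
Hypothesis ab_close : forall v, znorm (a v - b v) <= 1.
Hypothesis a_box : forall v (N : nat), znorm (a v) <= N%:Z -> v \in kbox N.+1.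

Let a_le v : znorm (a v) <= znorm (b v) + 1.
Proof.
by have := znormD (a v - b v) (b v); rewrite subrK; have := ab_close v; lia.
Qed.

Let b_le v : znorm (b v) <= znorm (a v) + 1.
Proof.
have h : znorm (b v - a v) <= 1 by rewrite -znormN opprB; exact: ab_close.
by have := znormD (b v - a v) (a v); rewrite subrK; lia.
Qed.

Definition ramp (M : nat) (x : int * int) : R :=
  (clip (plateau M x) M%:Z)%:~R / M%:R.

Lemma ramp_bounds M x : (0 < M)%N -> 0 <= ramp M x <= 1.
Proof.
move=> M0; rewrite /ramp; apply/andP; split.
  by rewrite divr_ge0 ?ler0n// ler0z /clip /plateau; lia.
rewrite ler_pdivrMr ?ltr0n// mul1r (_ : M%:R = M%:Z%:~R)// ler_int.
by rewrite /clip /plateau; lia.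
Qed.

Lemma ramp_in M x : (0 < M)%N -> znorm x <= M%:Z -> ramp M x = 1.
Proof.
move=> M0 h; rewrite /ramp clip_plateau_id ?normr_nat//.
by rewrite divff// pnatr_eq0 -lt0n.
Qed.

Lemma ramp_out M x : (2 * M)%N%:Z < znorm x -> ramp M x = 0.
Proof.
move=> h; rewrite /ramp.
have [->|/clip_plateau_supp] := eqVneq (clip (plateau M x) M%:Z) 0.
  by rewrite mul0r.
by lia.
Qed.

Lemma ramp_energy M (s : seq (kagome R)) : (0 < M)%N -> uniq s ->
  \sum_(v <- s) (ramp M (a v) - ramp M (b v)) ^+ 2 <= 243.
Proof.
move=> M0 us; have M0' : 0 < M%:R :> R by rewrite ltr0n.
rewrite (bigID [in kbox (2 * M).+2]) /= [X in _ + X]big1 ?addr0 => [|v vN].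
  apply: (@le_trans _ _ (\sum_(v <- s | v \in kbox (2 * M).+2) M%:R^-2)).
    apply: ler_sum => v _.
    rewrite -mulrBl exprMn exprVn ler_piMl ?invr_ge0 ?exprn_ge0// -rmorphB /=.
    rewrite -rmorphXn /= (_ : 1 = 1%:~R)// ler_int -real_normK ?num_real//.
    rewrite expr_le1//; have := clip_lip (b := plateau M (a v))
      (b' := plateau M (b v)) (t := M%:Z) (t' := M%:Z).
    apply; last by rewrite subrr.
    by have := plateau_lip M (b v) (ab_close v); rewrite [b v + _]addrC subrK.
  rewrite -big_filter big_const_seq count_predT iter_addr_0.
  rewrite -[leLHS]mulr_natl ler_pdivrMr ?exprn_gt0//.
  apply: (@le_trans _ _ (size (kbox (2 * M).+2))%:R).
    rewrite ler_nat; apply: uniq_leq_size; first exact: filter_uniq.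
    by move=> v; rewrite mem_filter => /andP[].
  rewrite size_kbox -natrX -natrM ler_nat; nia.
have av : (2 * M).+1%N%:Z < znorm (a v).
  by rewrite ltNge; apply: contra vN => /a_box.
rewrite !ramp_out ?subrr ?expr0n//; last by lia.
by have := a_le v; lia.
Qed.

(* [rho] is a sum of [K] ramps whose gradients have disjoint supports, so the
   energy of [rho / K] is at most [243 / K]. *)
Lemma cutoff_sum (K r0 : nat) : exists (rho : int * int -> R) (N : nat),
  [/\ (r0 <= N)%N, forall x, 0 <= rho x <= K%:R,
      forall x, znorm x <= r0%:Z -> rho x = K%:R,
      forall x, N%:Z < znorm x -> rho x = 0 &
      forall s, uniq s ->
        \sum_(v <- s) (rho (a v) - rho (b v)) ^+ 2 <= K%:R * 243].
Proof.
elim: K => [|K [rho [N [r0N rho01 rho_in rho_out energy]]]].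
  exists (fun=> 0), r0; split=> // [x|s _]; first by rewrite lexx.
  by rewrite big1 ?mul0r// => v _; rewrite subrr expr0n.
pose M := N.+1; exists (fun x => rho x + ramp M x), (2 * M)%N; split.
- by rewrite /M; lia.
- move=> x; have /andP[h1 h2] := rho01 x.
  have /andP[h3 h4] := ramp_bounds x (ltn0Sn N).
  by rewrite addr_ge0//= -natr1 lerD.
- by move=> x hx; rewrite rho_in// ramp_in// ?natr1// /M; lia.
- by move=> x hx; rewrite rho_out ?ramp_out ?addr0// /M; lia.
move=> s us; apply: (@le_trans _ _ (\sum_(v <- s) ((rho (a v) - rho (b v)) ^+ 2
    + (ramp M (a v) - ramp M (b v)) ^+ 2))).
  apply: ler_sum => v _; rewrite le_eqVlt; apply/orP; left; apply/eqP.
  have [/andP[ha hb]|] :=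
    boolP ((znorm (a v) <= M%:Z) && (znorm (b v) <= M%:Z)).
    by rewrite !ramp_in//; ring.
  move=> h; rewrite !rho_out; first by ring.
    by have := b_le v; have := a_le v; rewrite /M in h; lia.
  by have := b_le v; have := a_le v; rewrite /M in h; lia.
by rewrite big_split /= -natr1 mulrDl mul1r lerD ?energy ?ramp_energy.
Qed.

End cutoff.
End approximation.

Section density.
Context {R : realType}.

Lemma clip_real_lip (L s t : R) : 0 <= L ->
  `|Num.max (- L) (Num.min L s) - Num.max (- L) (Num.min L t)| <= `|s - t|.
Proof.
wlog st : s t / s <= t => [hw L0|L0].
  have [/hw/(_ L0) //|/ltW/hw/(_ L0) h] := leP s t.
  by rewrite distrC [leRHS]distrC.
have mono : Num.max (- L) (Num.min L s) <= Num.max (- L) (Num.min L t).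
  by rewrite le_max2 ?le_min2.
rewrite distrC [leRHS]distrC !ger0_norm ?subr_ge0//.
by rewrite !maxEle !minEle; do ![case: ifPn => //]; rewrite -?ltNge; lra.
Qed.

Lemma stream_approx (F : kagome R -> R) psi (e : R) :
  is_stream psi F -> sqsum F -> 0 < e ->
  exists (phi : int * int -> R) (G : kagome R -> R) (N : nat),
    [/\ is_stream phi G, forall x, x \notin box N -> phi x = 0 &
        forall s, uniq s -> \sum_(v <- s) (F v - G v) ^+ 2 <= e].
Proof.
move=> hpsi hF e0.
have [a [b [ab_close a_box ends]]] := @stream_ends R.
have [s0 hs0] := sqsum_tail hF (divr_gt0 e0 (ltr0n _ 16)).
pose L : R := \sum_(v <- s0) (`|psi (a v)| + `|psi (b v)|).
have L0 : 0 <= L by apply: sumr_ge0 => v _; rewrite addr_ge0.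
have hL v : v \in s0 -> `|psi (a v)| + `|psi (b v)| <= L.
  move=> vs0; rewrite /L (big_rem v)//= lerDl; apply: sumr_ge0 => w _.
  exact: addr_ge0.
have [r0 hr0] := seq_sub_box (map a s0 ++ map b s0).
pose K := (Num.truncn (2 * 2 * L ^+ 2 * 243 / e)).+1.
have K0 : 0 < K%:R :> R by rewrite ltr0n.
have KE : 2 * L ^+ 2 * 243 / K%:R <= e / 2.
  have : 2 * 2 * L ^+ 2 * 243 / e < K%:R by exact: truncnS_gt.
  by rewrite ltr_pdivrMr// ler_pdivrMr//; lra.
have [rho [N [r0N rho01 rho_in rho_out energy]]] :=
  cutoff_sum ab_close a_box K r0.
pose cl t := Num.max (- L) (Num.min L t).
have cl_le t : `|cl t| <= L.
  by rewrite ler_norml /cl le_max lexx /= ge_max ge_min lexx; lra.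
have cl_id t : `|t| <= L -> cl t = t.
  rewrite ler_norml => /andP[h1 h2].
  by rewrite /cl (min_idPr h2) (max_idPr h1).
pose phi x := rho x / K%:R * cl (psi x).
have phi0 x : x \notin box N -> phi x = 0.
  by rewrite mem_box -ltNge => /rho_out h; rewrite /phi h !mul0r.
have hG := finite_stream (R := R) phi0; set G := (fun v => _) in hG.
exists phi, G, N; split=> // s us.
pose d v := rho (a v) - rho (b v).
have on_s0 v : v \in s0 -> F v - G v = 0.
  move=> vs0; rewrite (ends _ _ hpsi) (ends _ _ hG) /phi.
  have hle := hL v vs0.
  have := normr_ge0 (psi (a v)); have := normr_ge0 (psi (b v)) => h1 h2.
  have va : a v \in box r0 by apply: hr0; rewrite mem_cat map_f.
  have vb : b v \in box r0 by apply: hr0; rewrite mem_cat map_f ?orbT.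
  rewrite !rho_in -?mem_box// divff ?gt_eqF// !mul1r !cl_id ?subrr//; lra.
have off_s0 v :
    (F v - G v) ^+ 2 <= 8 * F v ^+ 2 + 2 * L ^+ 2 / K%:R ^+ 2 * d v ^+ 2.
  have hc := clip_real_lip (psi (a v)) (psi (b v)) L0.
  rewrite -/(cl _) -/(cl _) -(ends _ _ hpsi) in hc.
  have Gle : `|G v| <= `|F v| + L / K%:R * `|d v|.
    rewrite (ends _ _ hG) /phi (_ : _ - _ = rho (a v) / K%:R *
      (cl (psi (a v)) - cl (psi (b v))) + cl (psi (b v)) / K%:R * d v);
      last by rewrite /d; ring.
    apply: le_trans (ler_normD _ _) _; rewrite !normrM; apply: lerD.
      have /andP[h1 h2] := rho01 (a v).
      rewrite -[leRHS]mul1r ler_pM// -normrM// ger0_norm ?divr_ge0//.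
      by rewrite ler_pdivrMr// mul1r.
    by rewrite ler_wpM2r// normfV normr_nat ler_wpM2r ?invr_ge0// ?cl_le ?ltW.
  have h1 : `|F v - G v| <= 2 * `|F v| + L / K%:R * `|d v|.
    by apply: le_trans (ler_normB _ _) _; lra.
  rewrite -[leLHS]real_normK ?num_real// -[F v ^+ 2]real_normK ?num_real//.
  rewrite -[d v ^+ 2]real_normK ?num_real//.
  apply: (@le_trans _ _ ((2 * `|F v| + L / K%:R * `|d v|) ^+ 2)).
    by rewrite lerXn2r ?nnegrE// (le_trans _ h1).
  rewrite -subr_ge0 (_ : _ - _ = (2 * `|F v| - L / K%:R * `|d v|) ^+ 2).
    exact: sqr_ge0.
  by rewrite -exprVn; ring.
rewrite (bigID [in s0]) /= big1 ?add0r => [|v vs0]; last first.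
  by rewrite on_s0 ?expr0n.
apply: (@le_trans _ _ (\sum_(v <- s | v \notin s0)
    (8 * F v ^+ 2 + 2 * L ^+ 2 / K%:R ^+ 2 * d v ^+ 2))).
  by apply: ler_sum => v _; exact: off_s0.
rewrite big_split /= -!mulr_sumr -!(big_filter _ (fun v => v \notin s0)).
have u0 : uniq [seq v <- s | v \notin s0] by exact: filter_uniq.
have h1 : \sum_(v <- [seq v <- s | v \notin s0]) F v ^+ 2 <= e / 16.
  by apply: hs0 => // v; rewrite mem_filter => /andP[].
have h2 : 2 * L ^+ 2 / K%:R ^+ 2 *
    \sum_(v <- [seq v <- s | v \notin s0]) d v ^+ 2 <= e / 2.
  apply: le_trans KE.
  apply: (@le_trans _ _ (2 * L ^+ 2 / K%:R ^+ 2 * (K%:R * 243))).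
    by rewrite ler_wpM2l ?energy// divr_ge0 ?exprn_ge0 ?mulr_ge0 ?sqr_ge0// ltW.
  by rewrite le_eqVlt; apply/orP; left; apply/eqP; field; rewrite gt_eqF.
lra.
Qed.

End density.

(** * Square-summable eigenfunctions *)

Section l2_partial_sums.
Context {R : realType} {T : choiceType}.
Implicit Types g : T -> R[i].

Lemma Re_norm_sqr (z : R[i]) :
  complex.Re `|z| ^+ 2 = complex.Re z ^+ 2 + complex.Im z ^+ 2.
Proof. by rewrite normc_def /= sqr_sqrtr// addr_ge0 ?sqr_ge0. Qed.

Lemma l2normsq_le g (M : R) :
  (forall s, uniq s ->
    \sum_(v <- s) (complex.Re (g v) ^+ 2 + complex.Im (g v) ^+ 2) <= M) ->
  (l2normsq g <= M%:E)%E.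
Proof.
move=> h; apply: ge_ereal_sup => _ [X [finX _]] <-.
rewrite fsbig_finite// sumEFin lee_fin.
under eq_bigr do rewrite Re_norm_sqr.
exact: h (fset_uniq _).
Qed.

Lemma l2normsq_ge g s : uniq s ->
  ((\sum_(v <- s) (complex.Re (g v) ^+ 2 + complex.Im (g v) ^+ 2))%:E
    <= l2normsq g)%E.
Proof.
move=> us; apply: esum_ge; exists [set` s].
  by split=> //; exact: finite_seq.
rewrite -fsbig_seq// sumEFin lee_fin.
by under [leRHS]eq_bigr do rewrite Re_norm_sqr.
Qed.

Lemma l2_sqsum g : l2 g <->
  sqsum (fun v => complex.Re (g v)) /\ sqsum (fun v => complex.Im (g v)).
Proof.
split=> [g2|[[M HM] [N HN]]]; last first.
  apply: (@le_lt_trans _ _ (M + N)%:E); last exact: ltry.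
  apply: l2normsq_le => s us; rewrite big_split /= lerD ?HM ?HN//.
have [M hM] : exists M : R, l2normsq g = M%:E.
  exists (fine (l2normsq g)); rewrite fineK// ge0_fin_numE//.
  by have := l2normsq_ge g (s := [::]) isT; rewrite big_nil.
have hs s : uniq s ->
    \sum_(v <- s) (complex.Re (g v) ^+ 2 + complex.Im (g v) ^+ 2) <= M.
  by move=> us; rewrite -lee_fin -hM; exact: l2normsq_ge.
split; exists M => s /hs; apply: le_trans; apply: ler_sum => v _.
  by rewrite lerDl sqr_ge0.
by rewrite lerDr sqr_ge0.
Qed.

Lemma l2normsq_pointwise g (e : R) v : 0 < e -> (l2normsq g < (e ^+ 2)%:E)%E ->
  `|complex.Re (g v)| <= e /\ `|complex.Im (g v)| <= e.
Proof.
move=> e0 he; have := le_lt_trans (l2normsq_ge g (s := [:: v]) isT) he.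
rewrite big_cons big_nil addr0 lte_fin => h.
have := sqr_ge0 (complex.Re (g v)); have := sqr_ge0 (complex.Im (g v)) => h1 h2.
by split; rewrite -(ler_pXn2r (n := 2)) ?nnegrE ?(ltW e0)//
  real_normK ?num_real//; lra.
Qed.

End l2_partial_sums.

Section balanced_functions.
Context {R : realType}.
Implicit Types (p q : kagome R -> R) (g h : kagome R -> R[i]).

Lemma balanced_complex g : balanced g <->
  balanced (fun v => complex.Re (g v)) /\ balanced (fun v => complex.Im (g v)).
Proof.
split=> [hg|[hp hq] m n].
  by split=> m n; have [h1 h2 h3] := hg m n;
    rewrite /up_sum /down_sum in h1 h2 h3;
    rewrite /up_sum /down_sum -?complex_ReD -?complex_ImD h1 h2 h3.
have [h1 h2 h3] := hp m n; have [h4 h5 h6] := hq m n.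
split; apply/eqP; rewrite eq_complex /up_sum /down_sum;
  rewrite !complex_ReD !complex_ImD; apply/andP;
  by split; apply/eqP.
Qed.

Lemma balanced_limit p :
  (forall e : R, 0 < e ->
    exists q, balanced q /\ forall v, `|p v - q v| <= e) ->
  balanced p.
Proof.
move=> hp; suff small (t : R) : (forall e : R, 0 < e -> `|t| <= 6 * e) -> t = 0.
  move=> m n; split; apply: small => e /hp[q [/(_ m n)[hA hB hC] pq]].
  - move: hA; rewrite /up_sum /down_sum /= => h1.
    have := pq (vA (m, n)); have := pq (vB (m, n)); have := pq (vC (m, n)).
    have := pq (vB (m - 1, n)); have := pq (vC (m, n - 1)).
    rewrite !ler_norml; lra.
  - move: hB; rewrite /up_sum /down_sum /= => h1.
    have := pq (vA (m, n)); have := pq (vB (m, n)); have := pq (vC (m, n)).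
    have := pq (vA (m + 1, n)); have := pq (vB (m + 1 - 1, n)).
    have := pq (vC (m + 1, n - 1)).
    rewrite !ler_norml; lra.
  - move: hC; rewrite /up_sum /down_sum /= => h1.
    have := pq (vA (m, n)); have := pq (vB (m, n)); have := pq (vC (m, n)).
    have := pq (vA (m, n + 1)); have := pq (vB (m - 1, n + 1)).
    have := pq (vC (m, n + 1 - 1)).
    rewrite !ler_norml; lra.
move=> ht; apply/eqP; rewrite -normr_le0 leNgt; apply/negP => t0.
by have := ht (`|t| / 12); lra.
Qed.

Lemma balanced_lin_comb (K : fieldType) (k : nat) (c : 'I_k -> K)
    (f : 'I_k -> kagome R -> K) :
  (forall i, balanced (f i)) -> balanced (lin_comb c f).
Proof.
move=> hf m n.
have aux (F G : 'I_k -> K) : (forall i, F i + G i = 0) ->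
    \sum_(i < k) c i * F i + \sum_(i < k) c i * G i = 0.
  by move=> FG; rewrite -big_split big1// => i _; rewrite /= -mulrDr FG mulr0.
have upE x : up_sum (lin_comb c f) x = \sum_(i < k) c i * up_sum (f i) x.
  by rewrite /up_sum /lin_comb -!big_split; apply: eq_bigr => i _;
    rewrite /= !mulrDr.
have downE x : down_sum (lin_comb c f) x = \sum_(i < k) c i * down_sum (f i) x.
  by rewrite /down_sum /lin_comb -!big_split; apply: eq_bigr => i _;
    rewrite /= !mulrDr.
by split; rewrite upE downE; apply: aux => i; case: (hf i m n).
Qed.

Lemma finite_support_sqsum (F : kagome R -> R) N :
  (forall v, v \notin kbox N -> F v = 0) -> sqsum F.
Proof.
move=> hF; exists (\sum_(v <- undup (kbox N)) F v ^+ 2) => s us.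
rewrite (bigID [in kbox N]) /= [X in _ + X]big1 ?addr0; last first.
  by move=> v /hF ->; rewrite expr0n.
rewrite -big_filter.
have -> : \sum_(v <- [seq v <- s | v \in kbox N]) F v ^+ 2 =
    \sum_(v <- [seq v <- undup (kbox N) | v \in s]) F v ^+ 2.
  apply: perm_big; apply: uniq_perm; rewrite ?filter_uniq ?undup_uniq// => v.
  by rewrite !mem_filter mem_undup andbC.
rewrite big_filter [leRHS](bigID [in s]) /= lerDl sumr_ge0// => v _.
exact: sqr_ge0.
Qed.

Lemma lap_eigenspace_complex (lambda : R) (F : kagome R -> R) :
  lap_eigenspace lambda F ->
  lap_eigenspace lambda%:C (fun v => (F v)%:C : R[i]).
Proof.
move=> h v; rewrite -rmorphM -h; move: v.
by apply: kagome_ind => -[m n]; rewrite ?laplacianA ?laplacianB ?laplacianC;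
  rewrite rmorphB fmorph_div rmorph_nat !rmorphD.
Qed.

Lemma finite_eigenvalue (F : kagome R -> R) lambda :
  F <> cst 0 -> finitely_supported F -> lap_eigenspace lambda F ->
  lambda = 3 / 2.
Proof.
move=> F0 /finitely_supported_kbox[N HN] /lap_eigenspace_complex h.
suff /(congr1 (@complex.Re R)) : lambda%:C = 3 / 2 :> R[i].
  by rewrite (_ : 3 / 2 = (3 / 2)%:C) // fmorph_div !rmorph_nat.
apply: sqsum_eigenvalue h; last first.
  move=> /(congr1 (fun g v => complex.Re (g v))) F1; apply: F0.
  by apply/funext => v; exact: (congr1 (fun f => f v) F1).
  by apply: (finite_support_sqsum (N := N)).
exact: finite_support_sqsum HN.
Qed.

Lemma eigen_hexagon_span (F : kagome R -> R) :
  finitely_supported F -> lap_eigenspace (3 / 2) F ->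
  lin_span [set hexagon_fun R H | H in [set: hexagon R]] F.
Proof.
move=> /finitely_supported_kbox[N HN] /eigen_balanced Fb.
have [U0 D0] := triangle_sums0 (finite_support_sqsum HN) Fb.
have [psi hpsi] := stream_exists U0 D0.
have [psi' [hpsi' h0]] := stream_finite_support hpsi HN.
exact: lin_span_hexagon hpsi' h0.
Qed.

Lemma balanced_approx (p : kagome R -> R) (e : R) :
  sqsum p -> balanced p -> 0 < e -> exists q N, [/\ balanced q,
    forall v, v \notin kbox N -> q v = 0 &
    forall s, uniq s -> \sum_(v <- s) (p v - q v) ^+ 2 <= e].
Proof.
move=> hp pb e0; have [U0 D0] := triangle_sums0 hp pb.
have [psi hpsi] := stream_exists U0 D0.
have [phi [q [N [hphi phi0 pq]]]] := stream_approx hpsi hp e0.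
exists q, N.+1; split=> //; first exact: stream_balanced hphi.
have phi0' x : ~~ (znorm x <= N%:Z) -> phi x = 0.
  by rewrite -mem_box; exact: phi0.
apply: kagome_ind => -[m n]; rewrite ?mem_kboxA ?mem_kboxB ?mem_kboxC => hx;
  have [eA eB eC] := hphi m n; rewrite ?eA ?eB ?eC !phi0' ?subrr//;
  by move: hx; rewrite /znorm /=; lia.
Qed.

Lemma l2_eigenspace_closure : l2_eigenspace R (3 / 2) =
  l2_closure (lin_span
    [set h | l2_eigenspace R (3 / 2) h /\ finitely_supported h]).
Proof.
apply/seteqP; split=>
  [g [g2 /eigen_balanced /balanced_complex[bp bq]]|g [g2 hg]].
  split=> // e e0; have [hp hq] := (l2_sqsum g).1 g2.
  have e4 : 0 < e ^+ 2 / 4 by rewrite divr_gt0 ?exprn_gt0.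
  have [p [N [pb p0 gp]]] := balanced_approx hp bp e4.
  have [q [M [qb q0 gq]]] := balanced_approx hq bq e4.
  pose h v : R[i] := p v +i* q v.
  exists h; last first.
    apply: (@le_lt_trans _ _ (e ^+ 2 / 2)%:E); last first.
      by rewrite lte_fin; have := exprn_gt0 2 e0; lra.
    apply: l2normsq_le => s us; have gps := gp s us; have gqs := gq s us.
    rewrite (eq_bigr (fun v => (complex.Re (g v) - p v) ^+ 2 +
      (complex.Im (g v) - q v) ^+ 2)) => [|v _]; last first.
      by rewrite /h /=; case: (g v).
    by rewrite big_split /=; lra.
  exists 1%N, (fun=> 1), (fun=> h); split; last first.
    by apply/funext => v; rewrite /lin_comb big_ord1 mul1r.
  move=> _; split; first split.
  - apply/l2_sqsum; split; first exact: finite_support_sqsum p0.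
    exact: finite_support_sqsum q0.
  - by apply/eigen_balanced/balanced_complex.
  - have [K HK] := seq_sub_kbox (@kbox R N ++ kbox M).
    apply/finitely_supported_kbox; exists K => v /negP vK.
    rewrite /h p0 ?q0//; apply/negP => vN; apply: vK; apply: HK;
    by rewrite mem_cat vN ?orbT.
split=> //; apply/eigen_balanced/balanced_complex.
have approx (e : R) : 0 < e -> exists h, balanced h /\ forall v,
    `|complex.Re (g v - h v)| <= e /\ `|complex.Im (g v - h v)| <= e.
  move=> e0; have [_ [n [c [f [hf ->]]]] he] := hg e e0.
  exists (lin_comb c f); split; last first.
    by move=> v; exact: (l2normsq_pointwise v e0 he).
  by apply: balanced_lin_comb => i; have [[_ /eigen_balanced]] := hf i.
split; apply: balanced_limit => e /approx[h [/balanced_complex[hp hq] hv]].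
  exists (fun v => complex.Re (h v)); split=> // v; have [+ _] := hv v.
  by case: (g v) (h v) => ? ? [].
exists (fun v => complex.Im (h v)); split=> // v; have [_ +] := hv v.
by case: (g v) (h v) => ? ? [].
Qed.

End balanced_functions.

Theorem proposition3p1 (R : realType) :
  (forall F : kagome R -> R,
     F <> cst 0 -> finitely_supported F ->
     (exists lambda : R, lap_eigenspace lambda F) ->
     lap_eigenspace (3 / 2) F /\
     lin_span [set hexagon_fun R H | H in [set: hexagon R]] F) /\
  (forall (k : nat) (H : 'I_k -> hexagon R),
     injective H ->
     lin_indep (fun i => hexagon_fun R (H i))) /\
  (forall (g : kagome R -> R[i]) (mu : R[i]),
     l2 g -> g <> cst 0 -> lap_eigenspace mu g -> mu = 3 / 2) /\
  l2_eigenspace R (3 / 2) =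
    l2_closure (lin_span
      [set h | l2_eigenspace R (3 / 2) h /\ finitely_supported h]).
Proof.
split=> [F F0 finF [lambda hF]|].
  have lambdaE := finite_eigenvalue F0 finF hF.
  rewrite lambdaE in hF; split=> //; exact: eigen_hexagon_span.
split; first by move=> k H; exact: hexagon_fun_indep.
split; last exact: l2_eigenspace_closure.
by move=> g mu /l2_sqsum[hp hq]; exact: sqsum_eigenvalue.
Qed.
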